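(* Let $n\ge 2$ and let $\gamma$ be an admissible Jordan arc with parametrization $\phi$. Let $f:\gamma\to\mathbb{C}$ be such that $f^{(n-1)}$ exists everywhere on $\gamma$ and $f^{(n-1)}\circ\phi$ is Lipschitz continuous on $[0,1]$. Then for every integer $k$ with $1\le k\le n$ and fixed $z_2,\dots,z_{k+1}\in\gamma$, the function $t_1\mapsto |d_k^{\,n-k}(f\,|\,\phi(t_1),z_2,\dots,z_{k+1})|$ is uniformly bounded almost everywhere on $[0,1]$, and for each $m=0,1,\dots,n-k-1$ the function $t_1\mapsto d_k^{\,m}(f\,|\,\phi(t_1),z_2,\dots,z_{k+1})$ is absolutely continuous on $[0,1]$ once an appropriate value is assigned at $\phi(t_1)=z_{k+1}$. Moreover, for $z_1\ne z_{k+1}$, \[ d_k^{\,m}(f\,|\,z_1,\dots,z_{k+1})=\frac{\int_{z_{k+1}}^{z_1}(z-z_{k+1})^m\, d_{k-1}^{\,m+1}(f\,|\,z,z_2,\dots,z_k)\,dz}{(z_1-z_{k+1})^{m+1}},\qquad k=1,\dots,n,\ m=0,\dots,n-k, \] where $d_n^{\,0}=d_n$ and $d_0^{\,n}=f^{(n)}$.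
   Context: A Jordan arc is the image of $[0,1]$ under a homeomorphism into $\mathbb{C}$; it is admissible if it is the image of a parametrization $\phi\in C^1([0,1])$ with $\phi'(t)\ne0$ for all $t\in[0,1]$ (one-sided at endpoints). For $g$ on $\gamma$, $g'(z_1)=\lim_{z\to z_1,\,z\in\gamma}\frac{g(z)-g(z_1)}{z-z_1}$; higher derivatives are defined inductively. For $z_1=\phi(t_1),z_2=\phi(t_2)$, $\int_{z_2}^{z_1}g(z)\,dz:=\int_{t_2}^{t_1}g(\phi(t))\phi'(t)\,dt$. Divided differences for distinct points are defined recursively by $d_0(f\,|\,z_1)=f(z_1)$ and $d_k(f\,|\,z_1,\dots,z_{k+1})=\frac{d_{k-1}(f\,|\,z_1,z_2,\dots,z_k)-d_{k-1}(f\,|\,z_{k+1},z_2,\dots,z_k)}{z_1-z_{k+1}}$; equivalently $d_n(f\,|\,z_1,\dots,z_{n+1})=\sum_{k=1}^{n+1}f(z_k)/\prod_{i\ne k}(z_k-z_i)$, which is symmetric in the nodes. The notation $d_k^{\,m}(f\,|\,z_1,\dots,z_{k+1})$ denotes the $m$-th derivative (along $\gamma$) of $d_k(f\,|\,z_1,\dots,z_{k+1})$ with respect to $z_1$, the other arguments being fixed. *)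

(* Defs.v *)
From HB Require Import structures.
From mathcomp Require Import all_boot all_order all_algebra.
From mathcomp Require Import all_classical all_reals all_analysis.
From mathcomp Require Import complex.
Set Implicit Arguments. Unset Strict Implicit. Unset Printing Implicit Defensive.
Import Order.TTheory GRing.Theory Num.Theory.
Import numFieldNormedType.Exports.
Local Open Scope classical_set_scope.
Local Open Scope ring_scope.

Section Defs.
Variable R : realType.
Local Notation C := (R[i]).

Definition cnorm (z : C) : R := Num.sqrt (complex.Re z ^+ 2 + complex.Im z ^+ 2).

Definition in01 (t : R) : Prop := 0 <= t <= 1.

(* phi : [0,1] -> C is an admissible parametrization with derivative dphi:
   injective on [0,1] (so phi is a homeomorphism of [0,1] onto the arc),
   dphi is the (one-sided at the endpoints) derivative of phi on [0,1],
   dphi is continuous on [0,1] and never vanishes there. *)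
Definition admissible_param (phi dphi : R -> C) : Prop :=
  [/\ (forall s t, in01 s -> in01 t -> phi s = phi t -> s = t),
      (forall t, in01 t -> dphi t != 0),
      (forall t, in01 t -> forall e : R, 0 < e -> exists2 d : R, 0 < d &
          forall s, in01 s -> s != t -> `|s - t| < d ->
            cnorm ((phi s - phi t) / Complex (s - t) 0 - dphi t) < e)
    & (forall t, in01 t -> forall e : R, 0 < e -> exists2 d : R, 0 < d &
          forall s, in01 s -> `|s - t| < d -> cnorm (dphi s - dphi t) < e)].

Definition on_arc (phi : R -> C) (z : C) : Prop := exists2 t, in01 t & phi t = z.

Definition is_arc_deriv (phi : R -> C) (g : C -> C) (z1 L : C) : Prop :=
  on_arc phi z1 /\
  forall e : R, 0 < e -> exists2 d : R, 0 < d &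
    forall z, on_arc phi z -> z != z1 -> cnorm (z - z1) < d ->
      cnorm ((g z - g z1) / (z - z1) - L) < e.

Fixpoint arc_derivn (phi : R -> C) (g : C -> C) (m : nat) : C -> C -> Prop :=
  match m with
  | 0%N => fun z v => on_arc phi z /\ v = g z
  | m'.+1 => fun z v => exists h : C -> C, exists2 d : R, 0 < d &
      (forall w, on_arc phi w -> cnorm (w - z) < d -> arc_derivn phi g m' w (h w))
      /\ is_arc_deriv phi h z v
  end.

(* divided difference d_{size zs - 1}(f | zs`_0, ..., zs`_(size zs - 1)),
   by the explicit formula  sum_k f(z_k) / prod_{i <> k} (z_k - z_i)
   (meaningful for pairwise distinct nodes) *)
Definition divdiff (f : C -> C) (zs : seq C) : C :=
  \sum_(k < size zs) f zs`_k / \prod_(i < size zs | i != k) (zs`_k - zs`_i).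

Definition ae01 (P : R -> Prop) : Prop :=
  (@lebesgue_measure R).-negligible [set t | in01 t /\ ~ P t].

Definition abs_cont01 (G : R -> C) : Prop :=
  forall e : R, 0 < e -> exists2 d : R, 0 < d &
    forall (N : nat) (a b : nat -> R),
      (forall i, (i < N)%N -> 0 <= a i /\ a i <= b i /\ b i <= 1) ->
      (forall i j, (i < j)%N -> (j < N)%N -> b i <= a j) ->
      \sum_(i < N) (b i - a i) < d ->
      \sum_(i < N) cnorm (G (b i) - G (a i)) < e.

Definition oint (a b : R) (h : R -> R) : R :=
  if a <= b then Rintegral (@lebesgue_measure R) `[a, b] h
  else - Rintegral (@lebesgue_measure R) `[b, a] h.

Definition cintegrable (a b : R) (H : R -> C) : Prop :=
  (@lebesgue_measure R).-integrable `[Order.min a b, Order.max a b] (EFin \o (fun t => complex.Re (H t))) /\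
  (@lebesgue_measure R).-integrable `[Order.min a b, Order.max a b] (EFin \o (fun t => complex.Im (H t))).

Definition cint (a b : R) (H : R -> C) : C :=
  Complex (oint a b (fun t => complex.Re (H t))) (oint a b (fun t => complex.Im (H t))).

End Defs.

(* Main.v *)
(* Everything is read in the parameter t of the arc: since phi' does not vanish,
   g has derivative L along the arc at phi(t) iff g o phi has derivative
   L phi'(t). A function on the arc is then described by the chain
   G_0, ..., G_N of its successive derivatives, where G_m' = G_(m+1) phi' and all
   G_m, including the last one, are Lipschitz. Passing from d_(k-1) to
   d_k(z) = (d_(k-1)(z) - d_(k-1)(w)) / (z - w) turns such a chain into
   Q_0 = (G_0 - G_0(w)) / (z - w), Q_(m+1) = (G_(m+1) - (m+1) Q_m) / (z - w),
   where the mean value inequality applied to (z - w)^(m+1) (Q_m - Q_m(w)) shows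
   that the quotients extend across w: Q_0, ..., Q_(N-1) are Lipschitz and Q_N is
   bounded. Finally (z - w)^(m+1) Q_m is Lipschitz, vanishes at w, and has
   derivative (z - w)^m G_m' almost everywhere, so it is the integral of that
   derivative. *)

Require Import Defs.
From HB Require Import structures.
From mathcomp Require Import all_boot all_order all_algebra.
From mathcomp Require Import all_classical all_reals all_analysis.
From mathcomp Require Import measurable_realfun complex.
From mathcomp Require Import ring lra zify.
Import Order.TTheory GRing.Theory Num.Theory.
Import numFieldNormedType.Exports.
Local Open Scope classical_set_scope.
Local Open Scope ring_scope.
Set Implicit Arguments. Unset Strict Implicit. Unset Printing Implicit Defensive.

(** * Lipschitz functions as integrals of their derivatives *)

Lemma lebesgue_stieltjes_measure_ocitv (R : realType) (f : cumulative R R) (a b : R) :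
  a <= b -> lebesgue_stieltjes_measure f `]a, b] = (f b - f a)%:E.
Proof.
move=> ab; rewrite /lebesgue_stieltjes_measure /measure_extension.
rewrite measurable_mu_extE; first exact: wlength_itv_bnd.
exact: is_ocitv.
Qed.

(* Both f and id - f are cumulative, and their Stieltjes measures add up to
   Lebesgue measure. *)
Lemma stieltjes_le_lebesgue (R : realType) (f : cumulative R R) (A : set R) :
  (forall x y, x <= y -> f y - f x <= y - x) -> measurable A ->
  (lebesgue_stieltjes_measure f A <= @lebesgue_measure R A)%E.
Proof.
move=> flip mA.
have nd : {homo (fun x => x - f x) : x y / x <= y}.
  by move=> x y /flip; lra.
have rc : right_continuous (fun x => x - f x).
  move=> x; apply: cvgB; first exact: cvg_within.
  exact: cumulative_is_right_continuous.
pose h : cumulative R R := HB.pack (fun x => x - f x) (isCumulative.Build R _ R _ nd rc).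
pose mu := measure_add (lebesgue_stieltjes_measure f) (lebesgue_stieltjes_measure h).
have -> : @lebesgue_measure R A = mu A.
  apply: lebesgue_stieltjes_measure_unique mA => X -[[a b] _ <-] /=.
  have [ab|ba] := leP a b; last first.
    by rewrite set_itv_ge ?measure0 // bnd_simp -leNgt ltW.
  rewrite /mu; transitivity
    (lebesgue_stieltjes_measure f `]a, b] + lebesgue_stieltjes_measure h `]a, b])%E;
    last by rewrite -measure_addE.
  rewrite !lebesgue_stieltjes_measure_ocitv //= -EFinD; congr EFin.
  by lra.
by rewrite /mu measure_addE leeDl // measure_ge0.
Qed.

(** The Stieltjes measure of [f] is dominated by Lebesgue measure, hence absolutely continuous;
    restricted to []a, b]] it is finite, and its Radon-Nikodym derivative is the density. *)
Lemma nondecreasing_contraction_density (R : realType) (f : R -> R) (a b : R) :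
  (forall x y, x <= y -> f x <= f y /\ f y - f x <= y - x) ->
  exists g : R -> R, (@lebesgue_measure R).-integrable setT (EFin \o g) /\
   forall x, a <= x <= b -> \int[@lebesgue_measure R]_(t in `[a, x]) g t = f x - f a.
Proof.
move=> flip.
have nd : {homo f : x y / x <= y} by move=> x y /flip[].
have rc : right_continuous f.
  move=> x; apply/cvgrPdist_lt => e e0; near=> y.
  have xy : x < y by near: y; exact: nbhs_right_gt.
  have /ltW/flip[fxy fyx] := xy.
  rewrite ler0_norm ?subr_le0 // opprB (le_lt_trans fyx) // ltrBlDl.
  by near: y; apply: nbhs_right_lt; rewrite ltrDl.
pose h : cumulative R R := HB.pack f (isCumulative.Build R _ R _ nd rc).
have [ab|ba] := leP a b; last first.
  exists (cst 0); split; last by move=> x /andP[/le_trans] h1 /h1; rewrite leNgt ba.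
  exact: integrable0.
have mD : measurable (`]a, b] : set (measurableTypeR R)) by exact: measurable_itv.
have Dfin : (lebesgue_stieltjes_measure h `]a, b] < +oo)%E.
  by rewrite lebesgue_stieltjes_measure_ocitv // ltry.
pose nu := charge_of_finite_measure (mfrestr mD Dfin).
have numu : nu `<< @lebesgue_measure R.
  move=> /= A nA B mB BA.
  apply/eqP; rewrite eq_le; apply/andP; split; last exact: measure_ge0.
  rewrite /nu /charge_of_finite_measure /mfrestr /mrestr.
  have mBD : measurable (B `&` `]a, b]) by apply: measurableI.
  have hlip x y : x <= y -> h y - h x <= y - x by move=> /flip[].
  have := stieltjes_le_lebesgue hlip mBD.
  by rewrite (nA _ mBD) // => x [/BA].
exists (fine \o Radon_Nikodym nu (@lebesgue_measure R)).
have gE : EFin \o (fine \o Radon_Nikodym nu (@lebesgue_measure R)) = Radon_Nikodym nu (@lebesgue_measure R).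
  by apply/funext => x /=; rewrite fineK // Radon_Nikodym_fin_num.
have gint : (@lebesgue_measure R).-integrable setT (EFin \o (fine \o Radon_Nikodym nu (@lebesgue_measure R))).
  by rewrite gE; apply: Radon_Nikodym_integrable.
split=> // x /andP[ax xb].
(* The point [a] has no Lebesgue mass, and the half-open interval is the one whose Stieltjes measure
   is [f x - f a]. *)
rewrite -Rintegral_itv_obnd_cbnd; last by apply: integrableS gint.
rewrite /Rintegral.
under eq_integral do rewrite /= fineK ?Radon_Nikodym_fin_num //.
rewrite -Radon_Nikodym_integral //.
transitivity (fine (lebesgue_stieltjes_measure h (`]a, x] `&` `]a, b]))) => //.
rewrite setIidl; first by rewrite lebesgue_stieltjes_measure_ocitv.
by apply: subset_itvl; rewrite bnd_simp.
Unshelve. all: by end_near. Qed.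

Lemma clamp_contraction (R : realType) (a b x y : R) : x <= y ->
  0 <= Num.max a (Num.min y b) - Num.max a (Num.min x b) <= y - x.
Proof.
by move=> xy; case: (leP x b) => ?; case: (leP y b) => ?; case: (leP a x) => ?;
  case: (leP a y) => ?; case: (leP a b) => ?; lra.
Qed.

(* Up to an affine change, a Lipschitz function is a nondecreasing contraction;
   its Stieltjes measure then has a Radon-Nikodym density, which Lebesgue's
   differentiation theorem identifies with the derivative. *)
Lemma lipschitz_ae_derivative (R : realType) (F : R -> R) (L : R) (a b : R) :
  (forall x y, a <= x <= b -> a <= y <= b -> `|F x - F y| <= L * `|x - y|) ->
  exists g : R -> R, [/\ (@lebesgue_measure R).-integrable `[a, b] (EFin \o g),
    {ae @lebesgue_measure R, forall x, a < x < b -> is_derive x 1 F (g x)} &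
    forall x y, a <= x -> x <= y -> y <= b -> \int[@lebesgue_measure R]_(t in `[x, y]) g t = F y - F x].
Proof.
move=> FL.
have [ab|ba] := leP a b; last first.
  exists (cst 0); split; first exact: integrable0.
    by apply: aeW => x /andP[/lt_trans h] /h; rewrite ltNge ltW.
  by move=> x y ax xy /(le_trans xy)/(le_trans ax); rewrite leNgt ba.
(* The maximum with 1 allows division by [K] whatever the sign of [L]. *)
pose K := Num.max L 1.
have K0 : 0 < K by rewrite lt_max ltr01 orbT.
(* Projecting onto [[a, b]] extends [F] to the whole line with Lipschitz constant [K]. *)
pose cl x := Num.max a (Num.min x b).
have clab x : a <= cl x <= b by rewrite /cl le_max lexx ge_max ab ge_min lexx orbT.
have clid x : a <= x <= b -> cl x = x.
  by move=> /andP[ax xb]; rewrite /cl min_l // max_r.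
have clle x y : x <= y -> 0 <= cl y - cl x <= y - x by exact: clamp_contraction.
(* The slopes of [F (cl x) / K] lie in [-1, 1], so those of [f] lie in [0, 1]. *)
pose f x := (F (cl x) / K + x) / 2.
have flip x y : x <= y -> f x <= f y /\ f y - f x <= y - x.
  move=> xy; have := FL _ _ (clab y) (clab x); have /andP[c0 c1] := clle _ _ xy.
  rewrite (ger0_norm c0) => h1.
  have h2 : `|F (cl y) / K - F (cl x) / K| <= y - x.
    rewrite -mulrBl normrM (gtr0_norm (x:=K^-1)) ?invr_gt0 // ler_pdivrMr //.
    apply: (le_trans h1); rewrite [leRHS]mulrC.
    apply: (@le_trans _ _ (K * (cl y - cl x))); last by rewrite ler_wpM2l // ltW.
    apply: ler_wpM2r => //.
    by rewrite le_max lexx.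
  by move: h2; rewrite ler_norml /f => /andP[]; lra.
have [g [gint gE]] := nondecreasing_contraction_density a b flip.
have FE x : a <= x <= b -> F x = K * (f x *+ 2 - x).
  move=> xab; rewrite /f clid // mulr2n -splitr addrK mulrC divfK //.
  by rewrite gt_eqF.
(* Solving for [F] as in [FE] turns the density [g] of [f] into this density of [F]. *)
pose g' x := K * 2 * g x - K.
have ic (S : set (measurableTypeR R)) c : measurable S -> S `<=` `[a, b] ->
    (@lebesgue_measure R).-integrable S (EFin \o fun=> c).
  move=> mS Sab; apply: (integrableS _ _ Sab) => //.
  apply: continuous_compact_integrable; first exact: segment_compact.
  exact/continuous_subspaceT/cst_continuous.
have iZ (S : set (measurableTypeR R)) : measurable S -> S `<=` `[a, b] ->
    (@lebesgue_measure R).-integrable S (EFin \o fun x => K * 2 * g x).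
  move=> mS Sab; have ig := integrableS measurableT mS (@subsetT _ S) gint.
  by apply: eq_integrable (integrableZl mS (K * 2) ig) => // x _ /=; rewrite EFinM.
have ig' (S : set (measurableTypeR R)) : measurable S -> S `<=` `[a, b] ->
    (@lebesgue_measure R).-integrable S (EFin \o g').
  move=> mS Sab.
  by apply: eq_integrable (integrableB mS (iZ S mS Sab) (ic S K mS Sab)) => // x _ /=; rewrite EFinB.
exists g'; split.
- exact: ig'.
- have gloc : locally_integrable [set: R] g.
    exact: open_integrable_locally openT gint.
  have iy y : (@lebesgue_measure R).-integrable [set` Interval (BLeft a) (BRight y)] (EFin \o g).
    by apply: integrableS gint.
  (* Lebesgue differentiation: the indefinite integral of [g] has derivative [g x] at almost every
     [x]. Near an interior [x], [F] is an affine expression in this integral and the variable. *)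
  have := FTC1 iy gloc.
  apply: filterS; first exact: (ae_filter_ringOfSetsType (@lebesgue_measure R)).
  move=> x hx /andP[ax xb].
  have [|dG dGE] := hx; first by rewrite lte_fin.
  set G := fun x => _ in dG dGE.
  have hG : is_derive x 1 G (g x).
    by rewrite -dGE derive1E; apply/derivableP.
  apply: (@near_eq_is_derive _ _ _ (fun x => K * ((G x + f a) *+ 2 - x))).
    near=> y.
    have ayb : a <= y <= b.
      apply/andP; split; apply: ltW; near: y; [exact: lt_nbhsr|exact: lt_nbhsl].
    by rewrite FE // /G gE // subrK.
  apply: is_derive_eq.
  rewrite /g' /GRing.scale /= addr0 mulr2n; ring.
- move=> x y ax xy yb.
  have ay : a <= y by apply: le_trans xy.
  have xb : x <= b by apply: le_trans yb.
  have sub : `[x, y] `<=` `[a, b] by apply: subset_itv; rewrite bnd_simp.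
  have gxy : \int[@lebesgue_measure R]_(t in `[x, y]) g t = f y - f x.
    have -> : f y - f x = (f y - f a) - (f x - f a) by lra.
    rewrite -!gE ?ax ?ay //.
    rewrite Rintegral_itvB ?bnd_simp //; last by apply: integrableS gint.
    by rewrite Rintegral_itv_obnd_cbnd //; apply: integrableS gint.
  have ixy : (@lebesgue_measure R).-integrable `[x, y] (EFin \o g) by apply: integrableS gint.
  rewrite /g' RintegralB ?RintegralZl //; last 2 first.
  + exact: iZ.
  + exact: ic.
  have lm : fine (@lebesgue_measure R `[x, y]) = y - x.
    rewrite lebesgue_measure_itv /= lte_fin; case: ltP => //= yx.
    by rewrite (le_anti (x := x) (y := y)) ?subrr // xy.
  rewrite gxy Rintegral_cst // (_ : fine _ = y - x); last exact: lm.
  rewrite !FE ?ax ?ay //.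
  by ring.
Unshelve. all: by end_near. Qed.

(** * Limits of complex-valued functions *)

Section ComplexNorm.
Variable R : realType.
Implicit Types z : R[i].
Lemma normcE z : `|z| = (cnorm z)%:C%C.
Proof. by rewrite normc_def; case: z. Qed.

Lemma cnorm_ge0 z : 0 <= cnorm z.
Proof. by rewrite /cnorm sqrtr_ge0. Qed.

Lemma cnorm_lt z (e : R) : (`|z| < e%:C%C) = (cnorm z < e).
Proof. by rewrite normcE ltcR. Qed.

Lemma cnormM z1 z2 : cnorm (z1 * z2) = cnorm z1 * cnorm z2.
Proof. by apply: complexI; rewrite -normcE normrM !normcE rmorphM. Qed.

Lemma cnormV z : cnorm z^-1 = (cnorm z)^-1.
Proof. by apply: complexI; rewrite -normcE normfV normcE fmorphV. Qed.

Lemma cnorm_triangle z1 z2 : cnorm (z1 + z2) <= cnorm z1 + cnorm z2.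
Proof. by rewrite -lecR rmorphD /= -!normcE ler_normD. Qed.

Lemma cnormN z : cnorm (- z) = cnorm z.
Proof. by apply: complexI; rewrite -!normcE normrN. Qed.

Lemma cnormB z1 z2 : cnorm (z1 - z2) = cnorm (z2 - z1).
Proof. by rewrite -cnormN opprB. Qed.

Lemma cnorm_real (x : R) : cnorm x%:C%C = `|x|.
Proof. by apply: complexI; rewrite -normcE normc_def /= expr0n addr0 sqrtr_sqr. Qed.

Lemma cnorm0 : cnorm (0 : R[i]) = 0.
Proof. by apply: complexI; rewrite -normcE normr0. Qed.

Lemma cnorm_gt0 z : (0 < cnorm z) = (z != 0).
Proof. by rewrite -normr_gt0 normcE ltcR. Qed.

Lemma cnormX z m : cnorm (z ^+ m) = cnorm z ^+ m.
Proof. by apply: complexI; rewrite -normcE normrX normcE rmorphXn. Qed.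

Lemma le_Re_cnorm z : `|complex.Re z| <= cnorm z.
Proof.
by rewrite /cnorm -sqrtr_sqr ler_wsqrtr // lerDl sqr_ge0.
Qed.

Lemma le_Im_cnorm z : `|complex.Im z| <= cnorm z.
Proof.
by rewrite /cnorm -sqrtr_sqr ler_wsqrtr // lerDr sqr_ge0.
Qed.

Lemma cnorm_le_ReIm z : cnorm z <= `|complex.Re z| + `|complex.Im z|.
Proof.
case: z => x y; have -> : (x +i* y)%C = x%:C%C + 'i%C * y%:C%C by simpc.
apply: (le_trans (cnorm_triangle _ _)); rewrite cnormM !cnorm_real.
have -> : cnorm ('i%C : R[i]) = 1 by rewrite /cnorm /= expr0n expr1n add0r sqrtr1.
by rewrite mul1r; simpc.
Qed.

(** Convergence is measured by the real-valued [cnorm], as in the definition of arc derivatives,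
    rather than by the norm with values in [R[i]]; [ccvgP] shows that both notions agree. *)
Definition ccvg (T : Type) (F : set_system T) (f : T -> R[i]) z :=
  forall e : R, 0 < e -> \forall x \near F, cnorm (f x - z) < e.

Local Notation C := (Num.NumField.sort (R[i] : numFieldType)).

Section Limits.
Variables (T : Type) (F : set_system T).
Context {FF : Filter F}.
Implicit Types f g : T -> R[i].

Lemma ccvgP f z : ccvg F f z <-> ((f : T -> C) @ F --> (z : C)).
Proof.
split=> [fz|/cvgrPdist_lt fz e e0]; last first.
  have := fz e%:C%C; rewrite ltcR => /(_ e0); apply: filterS => x.
  by rewrite cnorm_lt cnormB.
apply/cvgrPdist_lt => e e0.
(* A positive element of [R[i]] is real, so complex tolerances reduce to real ones. *)
have eE : e = (complex.Re e)%:C%C by apply/esym/RRe_real/gtr0_real.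
have {}e0 : 0 < complex.Re e by move: e0; rewrite eE ltcR.
by apply: filterS (fz _ e0) => x; rewrite eE cnorm_lt cnormB.
Qed.

Lemma ccvgD f g a b : ccvg F f a -> ccvg F g b -> ccvg F (fun x => f x + g x) (a + b).
Proof.
move=> fa gb e e0; have e2 : 0 < e / 2 by rewrite divr_gt0.
apply: filterS2 (fa _ e2) (gb _ e2) => x h1 h2.
have -> : f x + g x - (a + b) = (f x - a) + (g x - b) by ring.
by rewrite (le_lt_trans (cnorm_triangle _ _)) // (splitr e) ltrD.
Qed.

Lemma ccvgB f g a b : ccvg F f a -> ccvg F g b -> ccvg F (fun x => f x - g x) (a - b).
Proof.
move=> fa gb; apply: ccvgD fa _ => e /gb; apply: filterS => x.
by rewrite -opprD cnormN.
Qed.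

Lemma ccvgM f g a b : ccvg F f a -> ccvg F g b -> ccvg F (fun x => f x * g x) (a * b).
Proof. by move=> /ccvgP fa /ccvgP gb; apply/ccvgP; exact: cvgM. Qed.

Lemma ccvgV f a : a != 0 -> ccvg F f a -> ccvg F (fun x => (f x)^-1) a^-1.
Proof. by move=> a0 /ccvgP fa; apply/ccvgP; exact: cvgV. Qed.

Lemma ccvg_cst a : ccvg F (fun=> a) a.
Proof. by apply/ccvgP; exact: cvg_cst. Qed.

Lemma near_eq_ccvg f g a : (\forall x \near F, f x = g x) -> ccvg F f a -> ccvg F g a.
Proof. by move=> fg fa e /fa; apply: filterS2 fg => x ->. Qed.

Lemma ccvg_le f (g : T -> R) z :
  (\forall x \near F, cnorm (f x - z) <= g x) -> g @ F --> (0 : R) -> ccvg F f z.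
Proof.
move=> fg /cvgrPdist_lt g0 e e0.
apply: filterS2 fg (g0 _ e0) => x /le_lt_trans h; rewrite sub0r normrN => ge.
by apply: h; apply: le_lt_trans ge; rewrite ler_norm.
Qed.

Lemma ccvg_Re f z : ccvg F f z -> complex.Re (f x) @[x --> F] --> complex.Re z.
Proof.
move=> fz; apply/cvgrPdist_lt => e e0.
apply: filterS (fz _ e0) => x; apply: le_lt_trans.
by rewrite -raddfB /= cnormB le_Re_cnorm.
Qed.

Lemma ccvg_Im f z : ccvg F f z -> complex.Im (f x) @[x --> F] --> complex.Im z.
Proof.
move=> fz; apply/cvgrPdist_lt => e e0.
apply: filterS (fz _ e0) => x; apply: le_lt_trans.
by rewrite -raddfB /= cnormB le_Im_cnorm.
Qed.

Lemma ccvg_ReIm f z : complex.Re (f x) @[x --> F] --> complex.Re z ->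
  complex.Im (f x) @[x --> F] --> complex.Im z -> ccvg F f z.
Proof.
move=> /cvgrPdist_lt fr /cvgrPdist_lt fi e e0.
have e2 : 0 < e / 2 by rewrite divr_gt0.
apply: filterS2 (fr _ e2) (fi _ e2) => x h1 h2.
apply: (le_lt_trans (cnorm_le_ReIm _)).
by rewrite (splitr e) !raddfB ltrD // distrC.
Qed.

End Limits.
Lemma ccvg_unique (T : Type) (F : set_system T) {FF : ProperFilter F} (f : T -> R[i]) a b :
  ccvg F f a -> ccvg F f b -> a = b.
Proof.
move=> fa fb; apply/eqP; rewrite -subr_eq0 -[_ == 0]negbK -cnorm_gt0.
apply/negP => ab; have ab2 : 0 < cnorm (a - b) / 2 by rewrite divr_gt0.
have [x [h1 h2]] := filter_ex (filterI (fa _ ab2) (fb _ ab2)).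
have : cnorm (a - b) < cnorm (a - b); last by rewrite ltxx.
rewrite {2}(splitr (cnorm (a - b))).
have -> : a - b = (a - f x) + (f x - b) by ring.
have -> : a - f x + (f x - b) = a - b by ring.
rewrite -{1}(subrK (f x) a) -addrA (le_lt_trans (cnorm_triangle _ _)) //.
by apply: ltrD => //; rewrite (cnormB a (f x)).
Qed.

End ComplexNorm.

(** * Derivatives on [0, 1] *)

Section ParamDerivative.
Variable R : realType.
Implicit Types (H K : R -> R[i]) (s t : R) (L : R[i]).

(* Only parameters of [0, 1] approach t, so derivatives and limits at 0 and 1
   are one-sided. *)
Definition near01 t : set_system R := within (@in01 R) t^'.
Definition cderiv H t L := ccvg (near01 t) (fun s => (H s - H t) / (s - t)%:C%C) L.
Definition ccont H t := ccvg (near01 t) H (H t).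

Global Instance near01_filter t : Filter (near01 t).
Proof. exact: within_filter. Qed.

Lemma near01P t (P : R -> Prop) :
  (\forall s \near near01 t, P s) <->
  exists2 d, 0 < d & forall s, in01 s -> s != t -> `|s - t| < d -> P s.
Proof.
rewrite /near01 near_withinE; split.
  move=> /nbhs_ballP[d d0 dP]; exists d => // s s01 st sd.
  by apply: dP => //; rewrite /ball /= distrC.
move=> [d d0 dP]; apply/nbhs_ballP; exists d => // s; rewrite /ball /= => sd st s01.
by apply: dP => //; rewrite distrC.
Qed.

(** A step of at most 1/2 toward the farther endpoint stays in [0, 1], so every [t] of [0, 1] is a
    limit point of it. This is what makes one-sided limits unique. *)
Lemma near01_proper t : in01 t -> ProperFilter (near01 t).
Proof.
move=> t01; apply: Build_ProperFilter_ex => P /near01P[d d0 dP].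
have [t0 t1] := andP t01.
have [d' [d'0 d'd d'1]] : exists d', [/\ 0 < d', d' < d & d' <= 1 / 2].
  by exists (Num.min (d / 2) (1 / 2)); rewrite lt_min gt_min ge_min lexx orbT; split => //; lra.
have [th|th] := leP t (1 / 2).
  exists (t + d'); apply: dP; first by apply/andP; lra.
    by rewrite -subr_eq0 addrAC subrr add0r gt_eqF.
  by rewrite addrAC subrr add0r gtr0_norm.
exists (t - d'); apply: dP; first by apply/andP; lra.
  by rewrite -subr_eq0 addrAC subrr add0r oppr_eq0 gt_eqF.
by rewrite addrAC subrr add0r normrN gtr0_norm.
Qed.

Lemma near01_in t : \forall s \near near01 t, in01 s /\ s != t.
Proof. by apply/near01P; exists 1. Qed.

Lemma near01_lim t (c : R) : c * `|s - t| @[s --> near01 t] --> (0 : R).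
Proof.
apply/cvgrPdist_lt => e e0; apply/near01P; exists (e / (`|c| + 1)).
  by rewrite divr_gt0 // ltr_pwDr.
move=> s _ _; rewrite ltr_pdivlMr ?ltr_pwDr // => h.
rewrite sub0r normrN normrM normr_id (le_lt_trans _ h) // mulrC ler_wpM2l //.
by rewrite lerDl.
Qed.

Lemma ccvg_real_sub t : ccvg (near01 t) (fun s => (s - t)%:C%C) 0.
Proof.
apply: (@ccvg_le _ _ _ _ _ (fun s => 1 * `|s - t|)); last exact: near01_lim.
by near=> s; rewrite subr0 cnorm_real mul1r.
Unshelve. all: by end_near. Qed.

Lemma cderiv_unique H t L L' : in01 t -> cderiv H t L -> cderiv H t L' -> L = L'.
Proof. by move=> t01; apply: (@ccvg_unique _ _ _ (near01_proper t01)). Qed.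

Lemma near_eq_cderiv H K t L : H t = K t ->
  (\forall s \near near01 t, H s = K s) -> cderiv H t L -> cderiv K t L.
Proof.
by move=> HKt HK; apply: near_eq_ccvg; apply: filterS HK => s ->; rewrite HKt.
Qed.

Lemma cderiv_cont H t L : cderiv H t L -> ccont H t.
Proof.
move=> HL; rewrite /ccont -[X in ccvg _ _ X]addr0 -(mulr0 L).
apply: (@near_eq_ccvg _ _ _ _ (fun s => H t + (H s - H t) / (s - t)%:C%C * (s - t)%:C%C)).
  apply: filterS (near01_in t) => s [_ st].
  by rewrite divfK ?subrKC // (inj_eq (@complexI R) _ 0) subr_eq0.
apply: ccvgD; first exact: ccvg_cst.
by apply: ccvgM => //; exact: ccvg_real_sub.
Qed.

Lemma cderiv_cst a t : cderiv (fun=> a) t 0.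
Proof.
by apply: near_eq_ccvg (ccvg_cst _) => //; apply: nearW => s; rewrite subrr mul0r.
Qed.

Lemma cderivB H K t L L' : cderiv H t L -> cderiv K t L' ->
  cderiv (fun s => H s - K s) t (L - L').
Proof.
move=> h k; apply: near_eq_ccvg (ccvgB h k); apply: nearW => s.
by rewrite -mulrBl; congr (_ / _); ring.
Qed.

Lemma cderivM H K t L L' : cderiv H t L -> cderiv K t L' ->
  cderiv (fun s => H s * K s) t (L * K t + H t * L').
Proof.
move=> h k; have hc := cderiv_cont h.
apply: near_eq_ccvg (ccvgD (ccvgM h (ccvg_cst (K t))) (ccvgM hc k)).
by apply: nearW => s; rewrite mulrAC mulrA -mulrDl; congr (_ / _); ring.
Qed.

Lemma cderivX H t L m : cderiv H t L ->
  cderiv (fun s => H s ^+ m.+1) t (m.+1%:R * H t ^+ m * L).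
Proof.
move=> h; elim: m => [|m IH]; first by rewrite expr0 !mul1r.
have := cderivM h IH; congr cderiv; last by rewrite !exprS -[in RHS]natr1; ring.
Qed.

Lemma ccont_neq0 H t : ccont H t -> H t != 0 -> \forall s \near near01 t, H s != 0.
Proof.
move=> hc; rewrite -cnorm_gt0 => /hc; apply: filterS => s; apply: contraTneq => ->.
by rewrite sub0r cnormN ltxx.
Qed.

Lemma cderivV H t L : cderiv H t L -> H t != 0 ->
  cderiv (fun s => (H s)^-1) t (- L / H t ^+ 2).
Proof.
move=> h Ht; have hc := cderiv_cont h.
have -> : - L / H t ^+ 2 = L * (- (H t)^-1 * (H t)^-1) by field.
apply: near_eq_ccvg (ccvgM h (ccvgM (ccvg_cst (- (H t)^-1)) (ccvgV Ht hc))).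
apply: filterS2 (near01_in t) (ccont_neq0 hc Ht) => s [_ st] Hs.
have : (s - t)%:C%C != 0 :> R[i] by rewrite (inj_eq (@complexI R) _ 0) subr_eq0.
by move: (s - t)%:C%C => u u0; field; rewrite Ht Hs u0.
Qed.

Lemma cderiv_div H K t L L' : cderiv H t L -> cderiv K t L' -> K t != 0 ->
  cderiv (fun s => H s / K s) t ((L - H t / K t * L') / K t).
Proof.
move=> h k Kt; have := cderivM h (cderivV k Kt); congr cderiv.
by field.
Qed.

(** * Comparison with real derivatives and the mean value inequality *)

Lemma near01_interior t (P : R -> Prop) : 0 < t < 1 ->
  (\forall s \near near01 t, P s) -> \forall h \near 0^', P (h + t).
Proof.
move=> /andP[t0 t1] /near01P[d d0 dP].
apply/nbhs_ballP; exists (Num.min d (Num.min t (1 - t))) => /=.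
  by rewrite !lt_min d0 t0 subr_gt0.
move=> h; rewrite /ball /= sub0r normrN !lt_min ltr_norml => /and3P[/andP[h1 h2] h3 h4] h0.
apply: dP.
- by move: h3 h4; rewrite /in01 !ltr_norml => /andP[? ?] /andP[? ?]; apply/andP; lra.
- by rewrite -subr_eq0 addrK.
- by rewrite addrK ltr_norml h1.
Qed.

Lemma is_derive_near01 (f : R -> R) t (l : R) : 0 < t < 1 ->
  (f s - f t) / (s - t) @[s --> near01 t] --> l <-> is_derive t 1 f l.
Proof.
move=> t01; split.
  move=> /cvgrPdist_lt hl.
  have dl : h^-1 *: (f (h *: 1 + t) - f t) @[h --> 0^'] --> l.
    apply/cvgrPdist_lt => e /hl /(near01_interior t01); apply: filterS => h.
    by rewrite addrK /GRing.scale /= mulr1 mulrC.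
  by apply: DeriveDef; [apply/cvg_ex; exists l|apply/cvg_lim].
case=> df <-; rewrite /derive.
have /cvgrPdist_lt dl : h^-1 *: (f (h *: 1 + t) - f t) @[h --> 0^'] --> 'D_1 f t.
  exact: df.
apply/cvgrPdist_lt => e /dl; rewrite near_withinE => /nbhs_ballP[d d0 dP].
apply/near01P; exists d => // s _ st sd.
have := dP (s - t); rewrite /ball /= sub0r normrN => /(_ sd); rewrite subr_eq0 => /(_ st).
by rewrite /GRing.scale /= mulr1 subrK mulrC.
Qed.

Lemma diff_quotient_ReIm H s t :
  complex.Re ((H s - H t) / (s - t)%:C%C) = (complex.Re (H s) - complex.Re (H t)) / (s - t) /\
  complex.Im ((H s - H t) / (s - t)%:C%C) = (complex.Im (H s) - complex.Im (H t)) / (s - t).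
Proof.
rewrite -fmorphV; case: (H s) => a b; case: (H t) => c d /=.
by rewrite !mulr0 subr0 add0r; split => //; ring.
Qed.

(** A difference quotient in the parameter divides by a real number, so it splits into real and
    imaginary parts. *)
Lemma cderivP H t L : 0 < t < 1 -> cderiv H t L <->
  is_derive t 1 (fun s => complex.Re (H s)) (complex.Re L) /\
  is_derive t 1 (fun s => complex.Im (H s)) (complex.Im L).
Proof.
move=> t01; rewrite -!is_derive_near01 //.
have eR : (fun s => (complex.Re (H s) - complex.Re (H t)) / (s - t)) =
          (fun s => complex.Re ((H s - H t) / (s - t)%:C%C)).
  by apply/funext => s; rewrite (diff_quotient_ReIm H s t).1.
have eI : (fun s => (complex.Im (H s) - complex.Im (H t)) / (s - t)) =
          (fun s => complex.Im ((H s - H t) / (s - t)%:C%C)).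
  by apply/funext => s; rewrite (diff_quotient_ReIm H s t).2.
rewrite eR eI; split=> [h|[h1 h2]]; last exact: ccvg_ReIm.
by split; [exact: ccvg_Re|exact: ccvg_Im].
Qed.

Lemma continuous_within01 (f : R -> R) a b : 0 <= a -> b <= 1 -> a < b ->
  (forall x, a <= x <= b -> f s @[s --> near01 x] --> f x) ->
  {within `[a, b], continuous f}.
Proof.
move=> a0 b1 ab fc; apply/continuous_within_itvP => //.
have fd x : a <= x <= b -> forall e, 0 < e -> exists2 d, 0 < d &
    forall s, a < s < b -> `|s - x| < d -> `|f x - f s| < e.
  move=> /fc/cvgrPdist_lt fx e e0; have /near01P[d d0 dP] := fx e e0.
  exists d => // s /andP[sa sb] sd; have [->|sx] := eqVneq s x.
    by rewrite subrr normr0.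
  by apply: dP => //; apply/andP; lra.
split.
- move=> x; rewrite in_itv /= => /andP[ax xb]; apply/cvgrPdist_lt => e e0.
  have [|d d0 dP] := fd x _ e e0; first by rewrite !ltW.
  near=> s; apply: dP.
    by apply/andP; split; near: s; [exact: lt_nbhsr|exact: lt_nbhsl].
  by rewrite distrC; near: s; exact: cvgr_dist_lt.
- apply/cvgrPdist_lt => e e0.
  have [|d d0 dP] := fd a _ e e0; first by rewrite lexx ltW.
  near=> s; have as_ : a < s by near: s; exact: nbhs_right_gt.
  apply: dP; first by rewrite as_ /=; near: s; exact: nbhs_right_lt.
  rewrite gtr0_norm ?subr_gt0 // ltrBlDl.
  by near: s; apply: nbhs_right_lt; rewrite ltrDl.
- apply/cvgrPdist_lt => e e0.
  have [|d d0 dP] := fd b _ e e0; first by rewrite lexx ltW.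
  near=> s; have sb : s < b by near: s; exact: nbhs_left_lt.
  apply: dP; first by rewrite sb andbT; near: s; exact: nbhs_left_gt.
  rewrite distrC gtr0_norm ?subr_gt0 // ltrBlDl -ltrBlDr.
  by near: s; apply: nbhs_left_gt; rewrite ltrBlDr ltrDl.
Unshelve. all: by end_near. Qed.

(** The real mean value theorem is applied to the real and the imaginary part separately, with
    possibly different intermediate points; adding the two estimates costs the factor 2. *)
Lemma mean_value_cnorm H (D : R -> R[i]) M a b : 0 <= a -> b <= 1 -> a <= b ->
  (forall x, a <= x <= b -> ccont H x) ->
  (forall x, a < x < b -> cderiv H x (D x) /\ cnorm (D x) <= M) ->
  cnorm (H b - H a) <= M *+ 2 * (b - a).
Proof.
move=> a0 b1 ab Hc HD.
have [->|aNb] := eqVneq a b; first by rewrite !subrr mulr0 cnorm0.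
have {}ab : a < b by rewrite lt_neqAle aNb.
have x01 x : x \in `]a, b[ -> 0 < x < 1.
  by rewrite in_itv /= => /andP[ax xb]; rewrite (le_lt_trans a0 ax) (lt_le_trans xb b1).
have key (p : R[i] -> R) (f := fun s => p (H s)) :
    (forall x, a <= x <= b -> f s @[s --> near01 x] --> f x) ->
    (forall x, x \in `]a, b[ -> is_derive x 1 f (p (D x))) ->
    (forall z, `|p z| <= cnorm z) -> `|f b - f a| <= M * (b - a).
  move=> fc fd pn; have [c cab ->] := MVT ab fd (continuous_within01 a0 b1 ab fc).
  rewrite normrM (gtr0_norm (x := b - a)) ?subr_gt0 //.
  rewrite ler_wpM2r ?subr_ge0 ?(ltW ab) // (le_trans (pn _)) //.
  by move: cab; rewrite in_itv => /HD[].
apply: (le_trans (cnorm_le_ReIm _)); rewrite !raddfB mulrnAl mulr2n.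
apply: lerD; apply: key => [x xab|x xab|z].
- exact: ccvg_Re (Hc x xab).
- by have := xab; rewrite in_itv => /HD[/(cderivP _ _ (x01 _ xab))[]].
- exact: le_Re_cnorm.
- exact: ccvg_Im (Hc x xab).
- by have := xab; rewrite in_itv => /HD[/(cderivP _ _ (x01 _ xab))[]].
- exact: le_Im_cnorm.
Qed.

Lemma ccont_cnorm H t : ccont H t -> cnorm (H s) @[s --> near01 t] --> cnorm (H t).
Proof.
move=> Hc; apply/cvgrPdist_lt => e /Hc; apply: filterS => s; apply: le_lt_trans.
rewrite ler_norml; apply/andP; split.
  have := cnorm_triangle (H s - H t) (H t); rewrite subrK; lra.
have := cnorm_triangle (H t - H s) (H s); rewrite subrK cnormB; lra.
Qed.

Lemma ccont_bounded H : (forall t, in01 t -> ccont H t) ->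
  exists2 M, 0 < M & forall t, in01 t -> cnorm (H t) <= M.
Proof.
move=> Hc.
have fc x : 0 <= x <= 1 -> cnorm (H s) @[s --> near01 x] --> cnorm (H x).
  by move=> /Hc; exact: ccont_cnorm.
have [c _ cP] := EVT_max ler01 (continuous_within01 (lexx _) (lexx _) ltr01 fc).
exists (cnorm (H c) + 1); first by rewrite ltr_wpDl // cnorm_ge0.
move=> t t01; have := cP t; rewrite in_itv /= => /(_ t01); lra.
Qed.

Lemma ccont_neq0_bounded H : (forall t, in01 t -> ccont H t) ->
  (forall t, in01 t -> H t != 0) ->
  exists2 M, 0 < M & forall t, in01 t -> M <= cnorm (H t).
Proof.
move=> Hc H0.
have fc x : 0 <= x <= 1 -> cnorm (H s) @[s --> near01 x] --> cnorm (H x).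
  by move=> /Hc; exact: ccont_cnorm.
have [c c01 cP] := EVT_min ler01 (continuous_within01 (lexx _) (lexx _) ltr01 fc).
exists (cnorm (H c)); first by rewrite cnorm_gt0 H0 //; rewrite in_itv in c01.
by move=> t t01; apply: cP; rewrite in_itv.
Qed.

(** * Lipschitz functions on [0, 1] *)

Definition lipschitz01 H :=
  exists2 c : R, 0 <= c & forall s t, in01 s -> in01 t -> cnorm (H s - H t) <= c * `|s - t|.
Lemma lipschitz01_cont H : lipschitz01 H -> forall t, in01 t -> ccont H t.
Proof.
case=> c c0 cP t t01; apply: ccvg_le (near01_lim t c).
by apply: filterS (near01_in t) => s [s01 _]; exact: cP.
Qed.

Lemma lipschitz01_bounded H : lipschitz01 H ->
  exists2 M, 0 < M & forall t, in01 t -> cnorm (H t) <= M.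
Proof. by move=> /lipschitz01_cont; exact: ccont_bounded. Qed.

Lemma lipschitz01B H K : lipschitz01 H -> lipschitz01 K -> lipschitz01 (fun t => H t - K t).
Proof.
move=> [c c0 cP] [d d0 dP]; exists (c + d); first exact: addr_ge0.
move=> s t s01 t01; have -> : H s - K s - (H t - K t) = (H s - H t) + (K t - K s) by ring.
by rewrite (le_trans (cnorm_triangle _ _)) // mulrDl lerD ?cP // cnormB dP.
Qed.

Lemma lipschitz01M H K : lipschitz01 H -> lipschitz01 K -> lipschitz01 (fun t => H t * K t).
Proof.
move=> lH lK; have [M M0 MP] := lipschitz01_bounded lH; have [N N0 NP] := lipschitz01_bounded lK.
case: lH lK => [c c0 cP] [d d0 dP]; exists (c * N + M * d).
  by rewrite addr_ge0 // mulr_ge0 // ltW.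
move=> s t s01 t01.
have -> : H s * K s - H t * K t = (H s - H t) * K s + H t * (K s - K t) by ring.
rewrite (le_trans (cnorm_triangle _ _)) // [leRHS]mulrDl !cnormM lerD //.
  by rewrite mulrAC ler_pM ?cnorm_ge0 ?cP ?NP.
by rewrite -mulrA ler_pM ?cnorm_ge0 ?dP ?MP.
Qed.

Lemma lipschitz01_cst a : lipschitz01 (fun=> a).
Proof. by exists 0 => // s t _ _; rewrite subrr cnorm0 mul0r. Qed.

Lemma lipschitz01X H m : lipschitz01 H -> lipschitz01 (fun t => H t ^+ m).
Proof.
move=> lH; elim: m => [|m IH]; first by under eq_fun do rewrite expr0; exact: lipschitz01_cst.
by under eq_fun do rewrite exprS; exact: lipschitz01M.
Qed.

Lemma lipschitz01_abs_cont H : lipschitz01 H -> abs_cont01 H.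
Proof.
move=> [c c0 cP] e e0; exists (e / (c + 1)); first by rewrite divr_gt0 // ltr_wpDl.
move=> N a b ab _; rewrite ltr_pdivlMr ?ltr_wpDl // => h.
apply: (@le_lt_trans _ _ (c * \sum_(i < N) (b i - a i))).
  rewrite mulr_sumr ler_sum // => i _; have [a0 [leab b1]] := ab i (ltn_ord i).
  rewrite -(ger0_norm (x := b i - a i)) ?subr_ge0 //.
  apply: cP; apply/andP; split => //; [exact: le_trans leab|exact: le_trans b1].
apply: (le_lt_trans _ h); rewrite mulrC ler_wpM2l ?lerDl //.
by rewrite sumr_ge0 // => i _; have [a0 [leab b1]] := ab i (ltn_ord i); rewrite subr_ge0.
Qed.

(** An interval with [t0] in its interior is split there, and the mean value inequality applies to
    both halves. The exceptional point serves for difference quotients, whose derivative is first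
    known only away from the node. *)
Lemma cderiv_lipschitz01 H (D : R -> R[i]) M t0 : 0 <= M -> in01 t0 ->
  (forall t, in01 t -> ccont H t) ->
  (forall t, in01 t -> t != t0 -> cderiv H t (D t) /\ cnorm (D t) <= M) -> lipschitz01 H.
Proof.
move=> M0 /andP[t00 t01] Hc HD.
have side s t : in01 s -> in01 t -> s <= t -> ~~ (s < t0 < t) ->
    cnorm (H t - H s) <= M *+ 2 * (t - s).
  move=> /andP[s0 s1] /andP[tt0 tt1] st nst; apply: (mean_value_cnorm (D := D)) => //.
    by move=> x /andP[sx xt]; apply: Hc; apply/andP; lra.
  move=> x /andP[sx xt]; apply: HD; first by apply/andP; lra.
  by apply: contraNneq nst => <-; rewrite sx xt.
have M20 : 0 <= M *+ 2 by rewrite mulrn_wge0.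
have key s t : in01 s -> in01 t -> s <= t -> cnorm (H t - H s) <= M *+ 2 * (t - s).
  move=> s01 t01' st; have [/andP[st0 t0t]|] := boolP (s < t0 < t); last exact: side.
  have t0in : in01 t0 by apply/andP.
  have := side s t0 s01 t0in (ltW st0); rewrite ltxx andbF => /(_ isT) h1.
  have := side t0 t t0in t01' (ltW t0t); rewrite ltxx => /(_ isT) h2.
  have := cnorm_triangle (H t - H t0) (H t0 - H s).
  have -> : H t - H t0 + (H t0 - H s) = H t - H s by ring.
  have -> : t - s = (t - t0) + (t0 - s) by ring.
  by rewrite mulrDr; lra.
exists (M *+ 2) => // s t s01 t01'; have [st|/ltW ts] := leP s t.
  by rewrite cnormB distrC ger0_norm ?subr_ge0 ?key.
by rewrite ger0_norm ?subr_ge0 ?key.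
Qed.

End ParamDerivative.

(** * Derivatives along the arc *)

Section Arc.
Variables (R : realType) (phi dphi : R -> R[i]).
Hypothesis adm : admissible_param phi dphi.
Implicit Types (g h : R[i] -> R[i]) (s t : R) (z w v : R[i]).

Lemma phi_inj s t : in01 s -> in01 t -> phi s = phi t -> s = t.
Proof. by case: adm => + _ _ _; apply. Qed.

Lemma dphi_neq0 t : in01 t -> dphi t != 0.
Proof. by case: adm => _ + _ _; apply. Qed.

Lemma phi_cderiv t : in01 t -> cderiv phi t (dphi t).
Proof.
move=> t01 e e0; case: adm => _ _ + _ => /(_ t t01 e e0)[d d0 dP].
by apply/near01P; exists d.
Qed.

Lemma dphi_cont t : in01 t -> ccont dphi t.
Proof.
move=> t01 e e0; case: adm => _ _ _ => /(_ t t01 e e0)[d d0 dP].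
by apply/near01P; exists d => // s s01 _; exact: dP.
Qed.

Lemma phi_cont t : in01 t -> ccont phi t.
Proof. by move=> /phi_cderiv; exact: cderiv_cont. Qed.

Lemma phi_lipschitz : lipschitz01 phi.
Proof.
have [M M0 MP] := ccont_bounded dphi_cont.
apply: (@cderiv_lipschitz01 _ _ dphi M 0); [exact: ltW|by apply/andP|exact: phi_cont|].
by move=> t t01 _; split; [exact: phi_cderiv|exact: MP].
Qed.

Lemma phi_sub_neq0 s t : in01 s -> in01 t -> s != t -> phi s - phi t != 0.
Proof. by move=> s01 t01; apply: contraNneq => /subr0_eq /phi_inj ->. Qed.

Lemma real_sub_neq0 s t : s != t -> (s - t)%:C%C != 0 :> R[i].
Proof. by rewrite (inj_eq (@complexI R) _ 0) subr_eq0. Qed.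

(** The chord quotient, completed by [dphi t] at [t], is continuous on [0, 1]. It has no zero, by
    injectivity away from [t] and by [dphi t != 0] at [t], so compactness bounds it from below. *)
Lemma chord_lower_bound t : in01 t ->
  exists2 c, 0 < c & forall s, in01 s -> c * `|s - t| <= cnorm (phi s - phi t).
Proof.
move=> t01; pose h s := if s == t then dphi t else (phi s - phi t) / (s - t)%:C%C.
have ht : h t = dphi t by rewrite /h eqxx.
have hc s : in01 s -> ccont h s.
  move=> s01; have [->|st] := eqVneq s t.
    rewrite /ccont ht; apply: near_eq_ccvg (phi_cderiv t01).
    by apply: filterS (near01_in t) => r [_ /negbTE rt]; rewrite /h rt.
  have hs : h s = (phi s - phi t) / (s - t)%:C%C by rewrite /h (negbTE st).
  rewrite /ccont hs; apply: near_eq_ccvg.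
    apply/near01P; exists `|s - t|; first by rewrite normr_gt0 subr_eq0.
    move=> r _ _; rewrite /h; case: eqVneq => [->|_ _]; last exact: erefl.
    by rewrite distrC ltxx.
  apply: ccvgM; first by apply: ccvgB; [exact: phi_cont|exact: ccvg_cst].
  apply: ccvgV; first exact: real_sub_neq0.
  rewrite -[(s - t)%:C%C]add0r.
  apply: near_eq_ccvg (ccvgD (ccvg_real_sub s) (ccvg_cst (s - t)%:C%C)).
  by apply: nearW => r; rewrite -rmorphD /= subrKA.
have h0 s : in01 s -> h s != 0.
  move=> s01; have [->|st] := eqVneq s t; first by rewrite ht dphi_neq0.
  by rewrite /h (negbTE st) mulf_neq0 ?invr_neq0 ?phi_sub_neq0 ?real_sub_neq0.
have [c c0 cP] := ccont_neq0_bounded hc h0.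
exists c => // s s01; have [->|st] := eqVneq s t.
  by rewrite subrr normr0 mulr0 cnorm_ge0.
have := cP s s01; rewrite /h (negbTE st) cnormM cnormV cnorm_real.
by rewrite ler_pdivlMr // normr_gt0 subr_eq0.
Qed.

(** The quotient along the arc and the quotient in the parameter differ by the chord quotient, which
    tends to [dphi t != 0]. Passing between the two kinds of neighbourhoods uses continuity of [phi]
    one way and the chord bound the other way. *)
Lemma is_arc_derivP g t L : in01 t ->
  is_arc_deriv phi g (phi t) L <-> cderiv (fun s => g (phi s)) t (L * dphi t).
Proof.
move=> t01.
have q s : in01 s /\ s != t -> phi s - phi t != 0 /\ (s - t)%:C%C != 0 :> R[i].
  by move=> [s01 st]; rewrite phi_sub_neq0 ?real_sub_neq0.
split=> [[_ gP]|gP].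
  have gc : ccvg (near01 t) (fun s => (g (phi s) - g (phi t)) / (phi s - phi t)) L.
    move=> e /gP[d d0 dP].
    apply: filterS2 (near01_in t) (phi_cont t01 d0) => s [s01 st] sd.
    by apply: dP => //; [exists s|rewrite -subr_eq0 phi_sub_neq0].
  apply: (near_eq_ccvg _ (ccvgM gc (phi_cderiv t01))).
  apply: filterS (near01_in t) => s /q[q1 q2].
  by rewrite mulrA divfK.
split; first by exists t.
have gc : ccvg (near01 t) (fun s => (g (phi s) - g (phi t)) / (phi s - phi t)) L.
  have dt := dphi_neq0 t01.
  have -> : L = L * dphi t * (dphi t)^-1 by rewrite mulfK.
  apply: (near_eq_ccvg _ (ccvgM gP (ccvgV dt (phi_cderiv t01)))).
  apply: filterS (near01_in t) => s /q[q1 q2]; move: q2.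
  by move: (s - t)%:C%C => u u0; field; rewrite q1 u0.
move=> e e0; have /near01P[d d0 dP] := gc e e0.
have [c c0 cP] := chord_lower_bound t01.
(* A point of the arc within [c * d] of [phi t] has its parameter within [d] of [t]. *)
exists (c * d); first exact: mulr_gt0.
move=> z [s s01 <-] st sd; apply: dP => //.
  by apply: contraNneq st => ->.
by rewrite -(ltr_pM2l c0) (le_lt_trans (cP s s01)).
Qed.

(** Each order only asserts some function [h] of lower derivatives near the point. By induction two
    such functions agree on the arc near [z], so they have the same derivative there. *)
Lemma arc_derivn_uniq g m z v v' :
  arc_derivn phi g m z v -> arc_derivn phi g m z v' -> v = v'.
Proof.
elim: m z v v' => [|m IH] z v v' /=; first by move=> [_ ->] [_ ->].
move=> [h [d d0 [hP [[t t01 tz] hz]]]] [h' [d' d'0 [hP' [_ hz']]]].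
rewrite -{}tz in hz hz' hP hP' *.
have ht : is_arc_deriv phi h (phi t) v by split=> //; exists t.
have ht' : is_arc_deriv phi h' (phi t) v' by split=> //; exists t.
have hh s : in01 s -> cnorm (phi s - phi t) < d -> cnorm (phi s - phi t) < d' -> h (phi s) = h' (phi s).
  by move=> s01 sd sd'; apply: (IH (phi s)); [apply: hP|apply: hP'] => //; exists s.
move/is_arc_derivP : ht => /(_ t01) ht; move/is_arc_derivP : ht' => /(_ t01) ht'.
apply: (mulIf (dphi_neq0 t01)); apply: (cderiv_unique t01 _ ht').
apply: near_eq_cderiv ht; first by rewrite hh // subrr cnorm0.
have h1 := phi_cont t01 d0; have h2 := phi_cont t01 d'0.
by apply: filterS3 (near01_in t) h1 h2 => s [s01 _]; exact: hh.
Qed.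

Lemma arc_derivn_pred g m z v : arc_derivn phi g m.+1 z v -> exists v', arc_derivn phi g m z v'.
Proof.
move=> [h [d d0 [hP [zin _]]]]; exists (h z); apply: hP => //.
by rewrite subrr cnorm0.
Qed.

(* Junk value 0 off the arc. *)
Definition phi_inv z := xget 0 [set t | in01 t /\ phi t = z].
Lemma phi_invK t : in01 t -> phi_inv (phi t) = t.
Proof.
move=> t01; rewrite /phi_inv; case: xgetP => [s _ [s01 /phi_inj->//]|/(_ t)] /=.
by case.
Qed.

(** The finite set [S] holds the nodes, where [G] need not be the derivative. It keeps a positive
    distance from [phi t], and [G \o phi_inv] is the function on the arc required by the inductive
    definition. *)
Lemma arc_derivnS g m (G : R -> R[i]) (S : seq R[i]) t L :
  (forall s, in01 s -> phi s \notin S -> arc_derivn phi g m (phi s) (G s)) ->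
  in01 t -> phi t \notin S -> cderiv G t (L * dphi t) ->
  arc_derivn phi g m.+1 (phi t) L.
Proof.
move=> GP t01 tS dG.
have [d d0 dP] : exists2 d, 0 < d & forall z, cnorm (z - phi t) < d -> z \notin S.
  elim: S tS {GP} => [|x S IH]; first by exists 1.
  rewrite inE negb_or => /andP[tx /IH[d d0 dP]].
  exists (Num.min d (cnorm (x - phi t))).
    by rewrite lt_min d0 cnorm_gt0 subr_eq0 eq_sym.
  move=> z; rewrite lt_min => /andP[zd zx]; rewrite inE negb_or dP // andbT.
  by apply: contraTneq zx => ->; rewrite ltxx.
exists (G \o phi_inv); exists d => //; split.
  by move=> w [s s01 <-] sd /=; rewrite phi_invK //; apply: GP => //; exact: dP.
apply/is_arc_derivP => //; apply: near_eq_cderiv dG; first by rewrite /= phi_invK.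
by apply: filterS (near01_in t) => s [s01 _]; rewrite /= phi_invK.
Qed.

End Arc.

(** * Chains of derivatives of a difference quotient *)

Section DifferenceQuotient.
Variables (R : realType) (phi dphi : R -> R[i]).
Hypothesis adm : admissible_param phi dphi.
Variables (tw : R) (N : nat) (G : nat -> R -> R[i]).
Hypothesis tw01 : in01 tw.
Hypothesis GL : forall m, (m <= N)%N -> lipschitz01 (G m).
Hypothesis GD : forall m t, (m < N)%N -> in01 t -> cderiv (G m) t (G m.+1 t * dphi t).

Local Notation psi t := (phi t - phi tw).

(* Integrating the representation of d_k^m by parts gives
   (z - w) d_k^(m+1) = d_(k-1)^(m+1) - (m+1) d_k^m, which serves here as the
   definition of quot m = d_k^m from G m = d_(k-1)^m; its limit at w is
   d_(k-1)^(m+1)(w) / (m+1). *)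
Fixpoint quot_off m t : R[i] :=
  if m is m'.+1 then (G m t - m%:R * quot_off m' t) / psi t
  else (G 0 t - G 0 tw) / psi t.
Definition quot m t := if t == tw then G m.+1 tw / m.+1%:R else quot_off m t.

Lemma psi_neq0 t : in01 t -> t != tw -> psi t != 0.
Proof. by move=> t01; exact: (phi_sub_neq0 adm). Qed.

Lemma psi_cderiv t : in01 t -> cderiv (fun s => psi s) t (dphi t).
Proof.
move=> t01; rewrite -[dphi t]subr0.
by apply: cderivB; [exact: (phi_cderiv adm)|exact: cderiv_cst].
Qed.

Lemma quot0E t : in01 t -> psi t * quot 0 t = G 0 t - G 0 tw.
Proof.
rewrite /quot => t01; case: eqVneq => [->|ttw]; first by rewrite !subrr mul0r.
by rewrite mulrC divfK ?psi_neq0.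
Qed.

(** At [tw] both sides vanish, by the choice of the value of [quot m] there; the recursion in
    product form thus holds on all of [0, 1]. *)
Lemma quotSE m t : in01 t -> psi t * quot m.+1 t = G m.+1 t - m.+1%:R * quot m t.
Proof.
rewrite /quot => t01; case: eqVneq => [->|ttw].
  by rewrite subrr mul0r mulrC divfK ?subrr // pnatr_eq0.
by rewrite mulrC /= divfK ?psi_neq0.
Qed.

(** Quotient rule and induction: the derivative of the numerator of order [m.+1], minus the term
    from [psi], is [(G m.+2 - m.+1 * quot m.+1 - quot m.+1) * dphi], and the two multiples of
    [quot m.+1] add up to [m.+2]. *)
Lemma quot_cderiv_off m t : (m < N)%N -> in01 t -> t != tw ->
  cderiv (quot m) t (quot m.+1 t * dphi t).
Proof.
move=> mN t01 ttw.
have p0 := psi_neq0 t01 ttw.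
have near_ne : \forall s \near near01 t, in01 s /\ s != tw.
  apply/near01P; exists `|t - tw|; first by rewrite normr_gt0 subr_eq0.
  by move=> s s01 _ st; split=> //; apply: contraTneq st => ->; rewrite distrC ltxx.
elim: m mN => [|m IH] mN.
  apply: (@near_eq_cderiv _ (fun s => (G 0 s - G 0 tw) / psi s)).
  - by rewrite -quot0E // mulrC mulKf.
  - by apply: filterS near_ne => s [s01 stw]; rewrite -quot0E // mulrC mulKf // psi_neq0.
  have := cderiv_div (cderivB (GD mN t01) (cderiv_cst (G 0 tw) t)) (psi_cderiv t01) p0.
  congr cderiv; apply: (mulfI p0); rewrite [RHS]mulrA quotSE // -quot0E //.
  by field.
apply: (@near_eq_cderiv _ (fun s => (G m.+1 s - m.+1%:R * quot m s) / psi s)).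
- by rewrite -quotSE // mulrC mulKf.
- by apply: filterS near_ne => s [s01 stw]; rewrite -quotSE // mulrC mulKf // psi_neq0.
have := cderiv_div (cderivB (GD mN t01) (cderivM (cderiv_cst m.+1%:R t) (IH (ltnW mN))))
  (psi_cderiv t01) p0.
congr cderiv; apply: (mulfI p0); rewrite [RHS]mulrA (quotSE m.+1) // -(quotSE m) // -[m.+2%:R]natr1.
by field.
Qed.

Lemma quot_bound_of (q A : R -> R[i]) (a : R) :
  (forall t, in01 t -> psi t * q t = A t) ->
  (forall t, in01 t -> cnorm (A t) <= a * `|t - tw|) ->
  exists2 M, 0 < M & forall t, in01 t -> cnorm (q t) <= M.
Proof.
move=> qA Aa; have [c c0 cP] := chord_lower_bound adm tw01.
(* The equation [psi t * q t = A t] does not control [q] at [tw], hence the separate summand for its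
   value there. *)
exists (`|a| / c + cnorm (q tw) + 1).
  by rewrite ltr_wpDl // addr_ge0 ?cnorm_ge0 // divr_ge0 // ltW.
move=> t t01; have [->|ttw] := eqVneq t tw.
  have : 0 <= `|a| / c by rewrite divr_ge0 // ltW.
  lra.
apply: (@le_trans _ _ (`|a| / c)); last by rewrite -addrA lerDl addr_ge0 ?cnorm_ge0.
rewrite ler_pdivlMr // -(ler_pM2r (x := `|t - tw|)) ?normr_gt0 ?subr_eq0 //.
apply: (@le_trans _ _ (cnorm (A t))).
  by rewrite -qA // cnormM -mulrA [leRHS]mulrC ler_wpM2l ?cnorm_ge0 // cP.
by apply: (le_trans (Aa t t01)); rewrite ler_wpM2r // ler_norm.
Qed.

(* psi^(m+1) (quot m - quot m tw) vanishes at tw and has derivative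
   psi^m dphi (G_(m+1) - G_(m+1) tw) = O(|t - tw|^(m+1)). *)
Lemma quot_lipschitz_at m : (m < N)%N ->
  (exists2 M, 0 < M & forall t, in01 t -> cnorm (quot m t) <= M) ->
  exists2 c, 0 <= c & forall t, in01 t -> cnorm (quot m t - quot m tw) <= c * `|t - tw|.
Proof.
move=> mN [M M0 MP].
have [c c0 cP] := chord_lower_bound adm tw01.
have [K K0 KP] := phi_lipschitz adm.
have [B B0 BP] := ccont_bounded (dphi_cont adm).
have [L L0 LP] := GL mN.
pose I t := psi t ^+ m.+1 * (quot m t - quot m tw).
pose dI t := psi t ^+ m * dphi t * (G m.+1 t - G m.+1 tw).
have Itw : I tw = 0 by rewrite /I [X in _ * X]subrr mulr0.
have dIP t : in01 t -> t != tw -> cderiv I t (dI t).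
  move=> t01 ttw.
  have := cderivM (cderivX m (psi_cderiv t01))
    (cderivB (quot_cderiv_off mN t01 ttw) (cderiv_cst (quot m tw) t)).
  congr cderiv; rewrite /dI subr0 exprS.
  have -> : G m.+1 t = psi t * quot m.+1 t + m.+1%:R * quot m t by rewrite quotSE ?subrK.
  have -> : G m.+1 tw = m.+1%:R * quot m tw.
    by rewrite /quot eqxx mulrC divfK // pnatr_eq0.
  by ring.
have Ic t : in01 t -> ccont I t.
  move=> t01; have [->|ttw] := eqVneq t tw; last exact: cderiv_cont (dIP t t01 ttw).
  (* At [tw] a positive power of [psi] tends to 0 while the other factor is bounded by [M *+ 2]. *)
  have pc : ccvg (near01 tw) (fun s => psi s) 0.
    have := cderiv_cont (psi_cderiv tw01); rewrite /ccont; by rewrite subrr.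
  move=> e e0.
  have e' : 0 < e / (M *+ 2) by rewrite divr_gt0 // pmulrn_lgt0.
  apply: filterS3 (near01_in tw) (pc _ e') (pc _ ltr01) => s [s01 _].
  rewrite subr0 Itw => h1 h2; rewrite subr0 /I cnormM cnormX exprSr.
  have h3 : cnorm (quot m s - quot m tw) <= M *+ 2.
    rewrite (le_trans (cnorm_triangle _ _)) // cnormN mulr2n lerD //; exact: MP.
  apply: (@le_lt_trans _ _ (cnorm (psi s) * (M *+ 2))); last by rewrite -ltr_pdivlMr // pmulrn_lgt0.
  rewrite ler_pM ?mulr_ge0 ?exprn_ge0 ?cnorm_ge0 //.
  by rewrite ler_piMl ?cnorm_ge0 // exprn_ile1 ?cnorm_ge0 // ltW.
(* The factors bound [psi ^+ m], [dphi] and the increment of [G m.+1], up to powers of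
   [|t - tw|]. *)
pose C := K ^+ m * B * L.
have C0 : 0 <= C by rewrite !mulr_ge0 ?exprn_ge0 // ltW.
have main t : in01 t -> cnorm (I t) <= (C * `|t - tw| ^+ m.+1) *+ 2 * `|t - tw|.
  move=> t01.
  have dIb x : in01 x -> `|x - tw| <= `|t - tw| -> cnorm (dI x) <= C * `|t - tw| ^+ m.+1.
    move=> x01 xt; rewrite /dI !cnormM cnormX.
    apply: (@le_trans _ _ ((K * `|t - tw|) ^+ m * B * (L * `|t - tw|))).
      rewrite !ler_pM ?mulr_ge0 ?exprn_ge0 ?cnorm_ge0 //.
      - rewrite lerXn2r ?nnegrE ?cnorm_ge0 ?mulr_ge0 //.
        by rewrite (le_trans (KP _ _ x01 tw01)) // ler_wpM2l.
      - exact: BP.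
      - by rewrite (le_trans (LP _ _ x01 tw01)) // ler_wpM2l.
    by rewrite /C exprMn exprSr le_eqVlt; apply/orP; left; apply/eqP; ring.
  have [t0 t1] := andP t01; have [w0 w1] := andP tw01.
  have [tle|/ltW tle] := leP t tw.
    rewrite -cnormN -[- I t]add0r -Itw distrC [X in _ * X]ger0_norm ?subr_ge0 //.
    apply: (mean_value_cnorm (D := dI)) => // x /andP[xa xb].
      by apply: Ic; apply/andP; lra.
    have x01 : in01 x by apply/andP; lra.
    split; first by apply: dIP => //; rewrite lt_eqF.
    by rewrite [`|tw - t|]distrC; apply: dIb => //; rewrite !ler0_norm; lra.
  rewrite -[I t]subr0 -Itw [X in _ * X]ger0_norm ?subr_ge0 //.
  apply: (mean_value_cnorm (D := dI)) => // x /andP[xa xb].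
    by apply: Ic; apply/andP; lra.
  have x01 : in01 x by apply/andP; lra.
  split; first by apply: dIP => //; rewrite gt_eqF.
  by apply: dIb => //; rewrite !ger0_norm; lra.
(* Dividing the bound on [I] by [psi ^+ m.+1], which is at least [(c * |t - tw|) ^+ m.+1] in
   modulus, leaves one factor [|t - tw|]. *)
exists (C *+ 2 / c ^+ m.+1).
  by rewrite divr_ge0 ?mulrn_wge0 ?exprn_ge0 // ltW.
move=> t t01; have [->|ttw] := eqVneq t tw.
  by rewrite !subrr cnorm0 normr0 mulr0.
have n0 : 0 < `|t - tw| by rewrite normr_gt0 subr_eq0.
rewrite mulrAC ler_pdivlMr ?exprn_gt0 // -(ler_pM2r (x := `|t - tw| ^+ m.+1)) ?exprn_gt0 //.
apply: (@le_trans _ _ (cnorm (I t))).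
  rewrite /I cnormM cnormX -mulrA mulrC -exprMn ler_wpM2r ?cnorm_ge0 //.
  by rewrite lerXn2r ?nnegrE ?cnorm_ge0 ?mulr_ge0 ?(ltW c0) // cP.
apply: (le_trans (main t t01)); rewrite le_eqVlt; apply/orP; left; apply/eqP.
by rewrite -mulr_natl -[C *+ 2]mulr_natl; ring.
Qed.

(** Boundedness of [quot m] gives its Lipschitz estimate at [tw]; this makes the numerator of
    [quot m.+1] of order [|t - tw|], so [quot m.+1] is bounded. The induction reaches the top order
    [N]. *)
Lemma quot_bounded m : (m <= N)%N ->
  exists2 M, 0 < M & forall t, in01 t -> cnorm (quot m t) <= M.
Proof.
elim: m => [_|m IH mN].
  have [L L0 LP] := GL (leq0n N).
  by apply: (quot_bound_of quot0E) => t t01; exact: LP.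
have [c c0 cP] := quot_lipschitz_at mN (IH (ltnW mN)).
have [L L0 LP] := GL mN.
apply: (@quot_bound_of _ _ (L + m.+1%:R * c) (fun t => @quotSE m t)) => t t01.
have -> : G m.+1 t - m.+1%:R * quot m t =
    (G m.+1 t - G m.+1 tw) + m.+1%:R * (quot m tw - quot m t).
  have -> : G m.+1 tw = m.+1%:R * quot m tw.
    by rewrite /quot eqxx mulrC divfK // pnatr_eq0.
  by ring.
apply: (le_trans (cnorm_triangle _ _)); rewrite mulrDl lerD //; first exact: LP.
rewrite cnormM -mulrA ler_pM ?cnorm_ge0 //.
  by rewrite -(rmorph_nat (real_complex R)) cnorm_real ger0_norm.
by rewrite cnormB cP.
Qed.

(** Off [tw] the derivative is [quot m.+1 * dphi], bounded as long as [m.+1 <= N]; continuity at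
    [tw] comes from the Lipschitz estimate there. *)
Lemma quot_lipschitz m : (m < N)%N -> lipschitz01 (quot m).
Proof.
move=> mN; have [M M0 MP] := quot_bounded mN.
have [B B0 BP] := ccont_bounded (dphi_cont adm).
apply: (@cderiv_lipschitz01 _ _ (fun t => quot m.+1 t * dphi t) (M * B) tw) => //.
- by rewrite mulr_ge0 // ltW.
- move=> t t01; have [->|ttw] := eqVneq t tw; last exact: cderiv_cont (quot_cderiv_off mN t01 ttw).
  have [c c0 cP] := quot_lipschitz_at mN (quot_bounded (ltnW mN)).
  apply: ccvg_le (near01_lim tw c).
  by apply: filterS (near01_in tw) => s [s01 _]; exact: cP.
- move=> t t01 ttw; split; first exact: quot_cderiv_off.
  by rewrite cnormM ler_pM ?cnorm_ge0 ?MP ?BP.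
Qed.

(** At [tw], [quotSE] is solved for [quot m]. The product [psi * quot m.+1] is differentiable there
    because [psi] vanishes and [quot m.+1] is continuous, which is where [m.+1 < N] enters. *)
Lemma quot_cderiv m t : (m.+1 < N)%N -> in01 t -> cderiv (quot m) t (quot m.+1 t * dphi t).
Proof.
move=> mN t01; have [->|ttw] := eqVneq t tw; last exact: (quot_cderiv_off (ltnW mN)).
have m0 : m.+1%:R != 0 :> R[i] by rewrite pnatr_eq0.
have pq : cderiv (fun s => psi s * quot m.+1 s) tw (dphi tw * quot m.+1 tw).
  have qc : ccont (quot m.+1) tw by apply: lipschitz01_cont => //; exact: quot_lipschitz.
  apply: near_eq_ccvg (ccvgM (psi_cderiv tw01) qc).
  by apply: nearW => s; rewrite subrr !subr0 mul0r subr0 mulrAC.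
have := cderivM (cderiv_cst m.+1%:R^-1 tw) (cderivB (GD mN tw01) pq).
rewrite mul0r add0r; set L := (X in cderiv _ _ X).
have -> : L = quot m.+1 tw * dphi tw.
  have m20 : m.+2%:R != 0 :> R[i] by rewrite pnatr_eq0.
  have GE : G m.+2 tw = m.+2%:R * quot m.+1 tw.
    by rewrite /quot eqxx mulrC divfK.
  by rewrite /L GE -[m.+2%:R]natr1; field.
apply: near_eq_cderiv.
  by rewrite quotSE // opprB addrC subrK mulKf.
by apply: filterS (near01_in tw) => s [s01 _]; rewrite quotSE // opprB addrC subrK mulKf.
Qed.

(** The top quotient [quot N] is only known to be bounded. For positive order, one factor [psi] is
    absorbed by [quotSE], leaving [G] and a quotient of lower order, both Lipschitz. *)
Lemma quot_primitive_lipschitz m : (m <= N)%N -> lipschitz01 (fun t => psi t ^+ m.+1 * quot m t).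
Proof.
have lp : lipschitz01 (fun t => psi t).
  by apply: lipschitz01B; [exact: (phi_lipschitz adm)|exact: lipschitz01_cst].
have ext H K : (forall t, in01 t -> H t = K t) -> lipschitz01 H -> lipschitz01 K.
  move=> HK [c c0 cP]; exists c => // s t s01 t01.
  by rewrite -!HK // cP.
case: m => [_|m mN].
  apply: ext (lipschitz01B (GL (leq0n N)) (lipschitz01_cst (G 0 tw))) => t t01.
  by rewrite expr1 quot0E.
apply: ext (lipschitz01M (lipschitz01X m.+1 lp) (lipschitz01B (GL mN)
  (lipschitz01M (lipschitz01_cst m.+1%:R) (quot_lipschitz mN)))) => t t01.
by rewrite -quotSE // [in RHS]exprSr mulrA.
Qed.

(* psi^(m+1) quot m is the primitive of the integrand of the representation. *)
Lemma quot_primitive_cderiv m t g : (m <= N)%N -> in01 t -> t != tw -> cderiv (G m) t g ->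
  cderiv (fun s => psi s ^+ m.+1 * quot m s) t (psi t ^+ m * g).
Proof.
move=> mN t01 ttw dG.
have ext H K L : (forall s, in01 s -> H s = K s) -> cderiv H t L -> cderiv K t L.
  by move=> HK; apply: near_eq_cderiv; [exact: HK|apply: filterS (near01_in t) => s [/HK]].
case: m mN dG => [_|m mN] dG.
  apply: (ext (fun s => G 0 s - G 0 tw)) => [s s01|]; first by rewrite expr1 quot0E.
  by rewrite expr0 mul1r -[g]subr0; apply: cderivB dG (cderiv_cst _ _).
apply: (ext (fun s => psi s ^+ m.+1 * (G m.+1 s - m.+1%:R * quot m s))) => [s s01|].
  by rewrite -quotSE // mulrA -exprSr.
have := cderivM (cderivX m (psi_cderiv t01)) (cderivB dG
  (cderivM (cderiv_cst m.+1%:R t) (quot_cderiv_off mN t01 ttw))).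
by congr cderiv; rewrite -quotSE // exprS; ring.
Qed.

End DifferenceQuotient.

(** * Divided differences and densities *)

Section DivDiff.
Variable R : realType.
Implicit Types (f : R[i] -> R[i]) (z w : R[i]) (ws zs : seq R[i]).
Lemma divdiffE f zs : uniq zs ->
  divdiff f zs = \sum_(x <- zs) f x / \prod_(y <- zs | y != x) (x - y).
Proof.
move=> uzs; rewrite (big_nth 0) big_mkord; apply: eq_bigr => k _; congr (_ / _).
rewrite (big_nth 0) big_mkord; apply: eq_bigl => i.
by rewrite nth_uniq.
Qed.

(** The terms at [z] and [w] match directly; at a common node [x] the identity is the partial
    fraction [1 / ((x - z) (x - w)) = (1 / (x - z) - 1 / (x - w)) / (z - w)]. *)
Lemma divdiff_rcons f z ws w : uniq (z :: rcons ws w) ->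
  divdiff f (z :: rcons ws w) = (divdiff f (z :: ws) - divdiff f (w :: ws)) / (z - w).
Proof.
move=> u; have := u; rewrite cons_uniq rcons_uniq mem_rcons inE negb_or.
move=> /and3P[/andP[zw zws] wws uws].
rewrite !divdiffE //= ?zws ?wws //.
pose P x := \prod_(y <- ws | y != x) (x - y).
have PE x : \prod_(y <- z :: rcons ws w | y != x) (x - y) =
    (if z != x then x - z else 1) * P x * (if w != x then x - w else 1).
  rewrite big_cons -cats1 big_cat /= -/(P x).
  have -> : \prod_(i <- [:: w] | i != x) (x - i) = if w != x then x - w else 1.
    by rewrite big_cons big_nil mulr1.
  by case: (z != x); rewrite ?mul1r ?mulrA.
have P0 x : P x != 0.
  by rewrite /P prodf_seq_neq0; apply/allP => y _; apply/implyP; rewrite subr_eq0 eq_sym.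
have QE v x : \prod_(y <- v :: ws | y != x) (x - y) = (if v != x then x - v else 1) * P x.
  by rewrite big_cons; case: ifP; rewrite ?mul1r.
have S3 (h : R[i] -> R[i]) : \sum_(x <- z :: rcons ws w) h x = h z + (\sum_(x <- ws) h x + h w).
  by rewrite big_cons -cats1 big_cat big_seq1.
have S2 v (h : R[i] -> R[i]) : \sum_(x <- v :: ws) h x = h v + \sum_(x <- ws) h x.
  by rewrite big_cons.
rewrite S3 !S2 !PE !QE !eqxx zw [w == z]eq_sym zw /= !mul1r mulr1.
have -> : \sum_(x <- ws) f x / \prod_(y <- z :: rcons ws w | y != x) (x - y) =
    (\sum_(x <- ws) f x / \prod_(y <- z :: ws | y != x) (x - y) -
     \sum_(x <- ws) f x / \prod_(y <- w :: ws | y != x) (x - y)) / (z - w).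
  rewrite -sumrB mulr_suml; apply: eq_big_seq => x xws.
  have xz : z != x by apply: contraNneq zws => ->.
  have xw : w != x by apply: contraNneq wws => ->.
  rewrite PE !QE xz xw.
  by field; rewrite !subr_eq0 P0 zw ![x == _]eq_sym xz xw.
by field; rewrite !P0 !subr_eq0 zw [w == z]eq_sym zw.
Qed.

End DivDiff.

(** * Almost everywhere derivatives and complex integrals *)

Section Measure.
Variable R : realType.
Local Notation mu := (@lebesgue_measure R).
Implicit Types (H E : R -> R[i]).

Lemma negligible_seq (s : seq R) : mu.-negligible [set t : R | t \in s].
Proof.
elim: s => [|x s IH].
  by apply: negligibleS (negligible_set0 _).
have n1 : mu.-negligible [set x].
  by exists [set x]; split => //; exact: lebesgue_measure_set1.
apply: negligibleS (negligibleU n1 IH) => t /=; rewrite inE => /orP[/eqP ->|ts].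
  by left.
by right.
Qed.

Lemma ae01_of (P A : R -> Prop) (s : seq R) : {ae mu, forall t, A t} ->
  (forall t, in01 t -> t \notin s -> A t -> P t) -> ae01 P.
Proof.
move=> aeA AP.
apply: negligibleS (negligibleU aeA (negligible_seq s)) => t [t01 nP].
have [ts|ts] := boolP (t \in s); [by right|left] => /= At.
by apply: nP; exact: AP.
Qed.

Lemma lipschitz01_density H : lipschitz01 H ->
  exists g : R -> R[i], [/\
    mu.-integrable `[0, 1] (EFin \o (fun t => complex.Re (g t))),
    mu.-integrable `[0, 1] (EFin \o (fun t => complex.Im (g t))),
    {ae mu, forall t, 0 < t < 1 -> cderiv H t (g t)} &
    forall x y, 0 <= x -> x <= y -> y <= 1 ->
      \int[mu]_(t in `[x, y]) complex.Re (g t) = complex.Re (H y) - complex.Re (H x) /\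
      \int[mu]_(t in `[x, y]) complex.Im (g t) = complex.Im (H y) - complex.Im (H x)].
Proof.
case=> c _ cP.
have lr x y : 0 <= x <= 1 -> 0 <= y <= 1 -> `|complex.Re (H x) - complex.Re (H y)| <= c * `|x - y|.
  by move=> x01 y01; rewrite -raddfB (le_trans (le_Re_cnorm _)) ?cP.
have li x y : 0 <= x <= 1 -> 0 <= y <= 1 -> `|complex.Im (H x) - complex.Im (H y)| <= c * `|x - y|.
  by move=> x01 y01; rewrite -raddfB (le_trans (le_Im_cnorm _)) ?cP.
have [gr [ir dr Ir]] := lipschitz_ae_derivative lr.
have [gi [ii di Ii]] := lipschitz_ae_derivative li.
exists (fun t => (gr t +i* gi t)%C); split => //=.
  apply: filterS2 dr di; first exact: (ae_filter_ringOfSetsType mu).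
  by move=> t h1 h2 t01; apply/cderivP => //; split; [exact: h1|exact: h2].
by move=> x y x0 xy y1; split; [exact: Ir|exact: Ii].
Qed.

Lemma cderiv_real_unique H t (L L' : R[i]) : 0 < t < 1 -> cderiv H t L -> cderiv H t L' -> L = L'.
Proof.
move=> /andP[t0 t1]; apply: cderiv_unique.
by apply/andP; split; exact: ltW.
Qed.

Definition cmeasurable E :=
  measurable_fun (`[0, 1] : set (measurableTypeR R)) (fun t => complex.Re (E t)) /\
  measurable_fun (`[0, 1] : set (measurableTypeR R)) (fun t => complex.Im (E t)).
Lemma cmeasurableM H E : cmeasurable H -> cmeasurable E -> cmeasurable (fun t => H t * E t).
Proof.
move=> [hr hi] [er ei]; split.
  have -> : (fun t => complex.Re (H t * E t)) =
     (fun t => complex.Re (H t) * complex.Re (E t) - complex.Im (H t) * complex.Im (E t)).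
    by apply/funext => t; case: (H t) => a b; case: (E t).
  by apply: measurable_funB; apply: measurable_funM.
have -> : (fun t => complex.Im (H t * E t)) =
   (fun t => complex.Re (H t) * complex.Im (E t) + complex.Im (H t) * complex.Re (E t)).
  by apply/funext => t; case: (H t) => a b; case: (E t).
by apply: measurable_funD; apply: measurable_funM.
Qed.

Lemma lipschitz01_cmeasurable H : lipschitz01 H -> cmeasurable H.
Proof.
move=> /lipschitz01_cont Hc; split; apply: subspace_continuous_measurable_fun => //;
  apply: continuous_within01 => // x x01; [apply: ccvg_Re|apply: ccvg_Im]; exact: Hc.
Qed.

Lemma eq_cmeasurable H E : (forall t, in01 t -> H t = E t) -> cmeasurable H -> cmeasurable E.
Proof.
move=> HE [hr hi]; split.
  by apply: eq_measurable_fun hr => t; rewrite inE /= in_itv /= => /HE ->.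
by apply: eq_measurable_fun hi => t; rewrite inE /= in_itv /= => /HE ->.
Qed.

Lemma Rintegral_ae_eq01 (g e : R -> R) x y : 0 <= x -> y <= 1 ->
  mu.-integrable `[0, 1] (EFin \o g) ->
  measurable_fun (`[0, 1] : set (measurableTypeR R)) e ->
  {ae mu, forall t, 0 < t < 1 -> g t = e t} ->
  mu.-integrable `[x, y] (EFin \o e) /\
  \int[mu]_(t in `[x, y]) e t = \int[mu]_(t in `[x, y]) g t.
Proof.
move=> x0 y1 ig me ge.
have sub : `[x, y] `<=` (`[0, 1] : set R).
  by apply: subset_itv; rewrite bnd_simp.
have ig' : mu.-integrable `[x, y] (EFin \o g) by apply: integrableS ig.
have me' : measurable_fun (`[x, y] : set (measurableTypeR R)) (fun t => (e t)%:E).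
  by apply/measurable_EFinP; apply: measurable_funS me.
have aeE : ae_eq mu (`[x, y]%classic : set (measurableTypeR R)) (EFin \o g) (EFin \o e).
  (* The equality is known only on the open interval; the endpoints 0 and 1 are discarded as a null
     set. *)
  have n01 : {ae mu, forall t, t != 0 /\ t != 1 :> R}.
    apply: negligibleS (negligible_seq [:: 0; 1]) => t /= nt.
    by rewrite !inE; apply: contra_notT nt; rewrite negb_or => /andP.
  apply: filterS2 n01 ge; first exact: (ae_filter_ringOfSetsType mu).
  move=> t [t0 t1] h /=; rewrite in_itv /= => /andP[xt ty]; rewrite h //.
  by rewrite !lt_neqAle eq_sym t0 t1 (le_trans x0) // (le_trans ty).
split.
  apply/integrableP; split => //.
  have /integrableP[mg] := ig'; congr (_ < _)%E.
  apply: ae_eq_integral => //.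
  - exact: measurableT_comp.
  - exact: measurableT_comp.
  - by apply: filterS aeE => t h /h ->.
by rewrite /Rintegral; congr fine; apply: ae_eq_integral => //; [exact: measurable_int ig'|exact: ae_eq_sym].
Qed.

(* Measurability of E has to be assumed: Lebesgue measure is taken here on the
   Borel sets, so it does not pass to a.e. equal functions. *)
Lemma cint_density H E : lipschitz01 H -> cmeasurable E ->
  {ae mu, forall t, 0 < t < 1 -> cderiv H t (E t)} ->
  forall a b, in01 a -> in01 b -> cintegrable a b E /\ cint a b E = H b - H a.
Proof.
move=> lH [mr mi] dE a b a01 b01.
have [g [ir ii dg Ig]] := lipschitz01_density lH.
(* Both functions are derivatives of [H] almost everywhere, so they agree by uniqueness. *)
have gE : {ae mu, forall t, 0 < t < 1 -> g t = E t}.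
  apply: filterS2 dE dg; first exact: (ae_filter_ringOfSetsType mu).
  move=> t h1 h2 t01; exact: (cderiv_real_unique t01 (h2 t01) (h1 t01)).
have gEr : {ae mu, forall t, 0 < t < 1 -> complex.Re (g t) = complex.Re (E t)}.
  apply: filterS gE; first exact: (ae_filter_ringOfSetsType mu).
  by move=> t h /h ->.
have gEi : {ae mu, forall t, 0 < t < 1 -> complex.Im (g t) = complex.Im (E t)}.
  apply: filterS gE; first exact: (ae_filter_ringOfSetsType mu).
  by move=> t h /h ->.
have key x y : in01 x -> in01 y -> x <= y ->
  [/\ mu.-integrable `[x, y] (EFin \o (fun t => complex.Re (E t))),
      mu.-integrable `[x, y] (EFin \o (fun t => complex.Im (E t))),
      \int[mu]_(t in `[x, y]) complex.Re (E t) = complex.Re (H y - H x) &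
      \int[mu]_(t in `[x, y]) complex.Im (E t) = complex.Im (H y - H x)].
  move=> /andP[x0 x1] /andP[y0 y1] xy.
  have [r1 r2] := Rintegral_ae_eq01 x0 y1 ir mr gEr.
  have [i1 i2] := Rintegral_ae_eq01 x0 y1 ii mi gEi.
  have [I1 I2] := Ig x y x0 xy y1.
  by split => //; rewrite ?r2 ?i2 ?I1 ?I2 raddfB.
rewrite /cintegrable /cint /oint; have [ab|/ltW ba] := leP a b.
  have [k1 k2 -> ->] := key a b a01 b01 ab.
  by split => //; case: (H b - H a).
have [k1 k2 -> ->] := key b a b01 a01 ba.
split => //.
by rewrite -[RHS]opprB; case: (H a - H b).
Qed.

End Measure.

(** * Derivatives of divided differences *)

Section Chains.
Variables (R : realType) (phi dphi : R -> R[i]).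
Hypothesis adm : admissible_param phi dphi.
Implicit Types (f g : R[i] -> R[i]) (G : nat -> R -> R[i]).

Lemma chain_arc_derivn g (S : seq R[i]) G N :
  (forall t, in01 t -> phi t \notin S -> G 0 t = g (phi t)) ->
  (forall m t, (m < N)%N -> in01 t -> phi t \notin S -> cderiv (G m) t (G m.+1 t * dphi t)) ->
  forall m t, (m <= N)%N -> in01 t -> phi t \notin S -> arc_derivn phi g m (phi t) (G m t).
Proof.
move=> G0 dG; elim=> [|m IH] t mN t01 tS.
  by split; [exists t|exact: G0].
apply: (arc_derivnS adm (G := G m) (S := S)) => //; last exact: dG.
by move=> s s01 sS; apply: IH => //; exact: ltnW.
Qed.

Definition lipschitz_chain N G :=
  (forall m, (m <= N)%N -> lipschitz01 (G m)) /\
  (forall m t, (m < N)%N -> in01 t -> cderiv (G m) t (G m.+1 t * dphi t)).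

(** A derivative of order [N] entails all lower ones. They are selected by choice, and uniqueness
    identifies the selections with the functions inside the inductive definition. *)
Lemma arc_derivn_chain f (fn : R[i] -> R[i]) N :
  (forall z, on_arc phi z -> arc_derivn phi f N z (fn z)) ->
  (exists Lc : R, forall s t, in01 s -> in01 t ->
      cnorm (fn (phi s) - fn (phi t)) <= Lc * `|s - t|) ->
  exists2 G, lipschitz_chain N G & forall t, in01 t -> G 0 t = f (phi t).
Proof.
move=> fnP [c cP].
have ex m t : (m <= N)%N -> in01 t -> exists v, arc_derivn phi f m (phi t) v.
  move=> mN t01; rewrite -(subKn mN); elim: (N - m)%N => [|j [v IH]].
    by rewrite subn0; exists (fn (phi t)); apply: fnP; exists t.
  have [Nj|jN] := leqP N j.
    by exists v; move: IH; rewrite (eqP (leqW Nj)) (eqP Nj).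
  by apply: (arc_derivn_pred (v := v)); rewrite -subSn.
pose G m t := xget 0 [set v | arc_derivn phi f m (phi t) v].
have GP m t : (m <= N)%N -> in01 t -> arc_derivn phi f m (phi t) (G m t).
  by move=> mN t01; rewrite /G; case: xgetP => [v _ //|h]; have [v /h] := ex m t mN t01.
have dG m t : (m < N)%N -> in01 t -> cderiv (G m) t (G m.+1 t * dphi t).
  move=> mN t01; have [h [d d0 [hP hd]]] := GP m.+1 t mN t01.
  move/(is_arc_derivP adm _ _ t01): hd; apply: near_eq_cderiv.
    apply: (arc_derivn_uniq adm _ (GP m t (ltnW mN) t01)).
    by apply: hP; [exists t|rewrite subrr cnorm0].
  apply: filterS2 (near01_in t) (phi_cont adm t01 d0) => s [s01 _] sd.
  by apply: (arc_derivn_uniq adm _ (GP m s (ltnW mN) s01)); apply: hP => //; exists s.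
exists G; last by move=> t t01; have [] := GP 0 t (leq0n N) t01.
(* Descending induction from order [N], where the Lipschitz bound is given: below it, boundedness of
   the next derivative makes each function Lipschitz. *)
split=> // m mN; rewrite -(subKn mN); elim: (N - m)%N (leq_subr m N) => [_|j IH jN].
  rewrite subn0; exists `|c| => // s t s01 t01.
  have GN r : in01 r -> G N r = fn (phi r).
    move=> r01; apply: (arc_derivn_uniq adm (GP N r (leqnn N) r01)).
    by apply: fnP; exists r.
  by rewrite !GN // (le_trans (cP s t s01 t01)) // ler_wpM2r // ler_norm.
have [M M0 MP] := lipschitz01_bounded (IH (ltnW jN)).
have [B B0 BP] := ccont_bounded (dphi_cont adm).
have jl : (N - j.+1 < N)%N by rewrite ltn_subrL /= (leq_ltn_trans _ jN).
have d t : in01 t -> cderiv (G (N - j.+1)%N) t (G (N - j)%N t * dphi t).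
  by move=> t01; have := dG _ _ jl t01; rewrite subnSK.
apply: (cderiv_lipschitz01 (D := fun t => G (N - j)%N t * dphi t) (M := M * B) (t0 := 0)).
- by rewrite mulr_ge0 // ltW.
- by apply/andP.
- by move=> t t01; exact: cderiv_cont (d t t01).
- by move=> t t01 _; split; [exact: d|rewrite cnormM ler_pM ?cnorm_ge0 ?MP ?BP].
Qed.

Lemma quot0_divdiff f ws tw G t : in01 tw -> in01 t ->
  uniq (rcons ws (phi tw)) -> phi t \notin rcons ws (phi tw) ->
  (forall s, in01 s -> phi s \notin ws -> G 0 s = divdiff f (phi s :: ws)) ->
  quot phi tw G 0 t = divdiff f (phi t :: rcons ws (phi tw)).
Proof.
move=> tw01 t01 u tn G0.
rewrite divdiff_rcons ?cons_uniq ?tn ?u //.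
move: u tn; rewrite rcons_uniq mem_rcons inE negb_or => /andP[wws _] /andP[tw_ tws].
rewrite -(G0 t) // -(G0 tw) // -(quot0E adm G tw01 t01) mulrC mulKf //.
by rewrite subr_eq0.
Qed.

(** Appending a node replaces the chain by its difference quotients at that node. Each node costs
    one order, since the top quotient is bounded but not known to be Lipschitz. *)
Lemma divdiff_chain f N G0 ws :
  lipschitz_chain N G0 -> (forall t, in01 t -> G0 0 t = f (phi t)) ->
  (size ws <= N)%N -> uniq ws -> (forall z, z \in ws -> on_arc phi z) ->
  exists2 G, lipschitz_chain (N - size ws) G &
    forall t, in01 t -> phi t \notin ws -> G 0 t = divdiff f (phi t :: ws).
Proof.
move=> cG0 G0E; elim/last_ind: ws => [_ _ _|ws w IH].
  exists G0; first by rewrite subn0.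
  by move=> t t01 _; rewrite G0E // divdiffE // !big_seq1 big_cons eqxx big_nil divr1.
rewrite size_rcons => sN u wsP.
have uws : uniq ws by move: u; rewrite rcons_uniq => /andP[].
have [z zws|G [GL GD] G0'] := IH (ltnW sN) uws; first by apply: wsP; rewrite mem_rcons inE zws orbT.
have wws : w \in rcons ws w by rewrite mem_rcons mem_head.
have [tw tw01 twE] := wsP w wws.
exists (quot phi tw G).
  split=> [m mN|m t mN t01].
    by apply: (quot_lipschitz adm tw01 GL GD); move: mN; lia.
  by apply: (quot_cderiv adm tw01 GL GD) => //; move: mN; lia.
move=> t t01; rewrite -twE => tn.
by apply: quot0_divdiff => //; rewrite twE.
Qed.

End Chains.

(** * Bounds, absolute continuity and integral representation of the derivatives of divided
    differences *)

Theorem theorem1 (R : realType) (n : nat) (phi dphi : R -> R[i]) (f fn1 : R[i] -> R[i]) :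
  (2 <= n)%N ->
  admissible_param phi dphi ->
  (forall z, on_arc phi z -> arc_derivn phi f n.-1 z (fn1 z)) ->
  (exists Lc : R, forall s t, in01 s -> in01 t ->
      cnorm (fn1 (phi s) - fn1 (phi t)) <= Lc * `|s - t|) ->
  forall (k : nat) (ws : seq R[i]) (w : R[i]),
    (1 <= k <= n)%N -> size ws = k.-1 -> uniq (rcons ws w) ->
    (forall z, z \in rcons ws w -> on_arc phi z) ->
    [/\ (* d_k^{n-k} is uniformly bounded a.e. on [0,1] *)
        (exists M : R, ae01 (fun t =>
           exists2 v, arc_derivn phi (fun z => divdiff f (z :: rcons ws w)) (n - k) (phi t) v
                    & cnorm v <= M)),
        (* for m < n-k, t1 |-> d_k^m(f | phi t1, ...) extends to an AC function on [0,1] *)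
        (forall m, (m < n - k)%N -> exists G : R -> R[i], abs_cont01 G /\
           (forall t, in01 t -> phi t \notin rcons ws w ->
              arc_derivn phi (fun z => divdiff f (z :: rcons ws w)) m (phi t) (G t)))
      & (* integral representation, for z1 = phi t1 <> z_{k+1} = phi tw *)
        (forall m, (m <= n - k)%N -> forall t1 tw : R, in01 t1 -> in01 tw ->
           phi tw = w -> phi t1 \notin rcons ws w ->
           exists h : R -> R[i],
             ae01 (fun t => arc_derivn phi (fun z => divdiff f (z :: ws)) m.+1 (phi t) (h t)) /\
             cintegrable tw t1 (fun t => (phi t - w) ^+ m * h t * dphi t) /\
             arc_derivn phi (fun z => divdiff f (z :: rcons ws w)) m (phi t1)
               (cint tw t1 (fun t => (phi t - w) ^+ m * h t * dphi t) / (phi t1 - w) ^+ m.+1))].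
Proof.
move=> n2 adm fP fL k ws w /andP[k1 kn] sws u wsP.
have [F cF F0] := arc_derivn_chain adm fP fL.
have uws : uniq ws by move: u; rewrite rcons_uniq => /andP[].
have [|z zws|G] := divdiff_chain adm (f := f) (ws := ws) cF F0 _ uws.
- by rewrite sws; lia.
- by apply: wsP; rewrite mem_rcons inE zws orbT.
(* The chain of [f] has length [n - 1] and [ws] has [k - 1] nodes, so the chain of d_(k-1) has
   length [n - k]. *)
rewrite sws (_ : (n.-1 - k.-1)%N = (n - k)%N); last by lia.
move=> [GL GD] G0.
have wws : w \in rcons ws w by rewrite mem_rcons mem_head.
have [tw tw01 twE] := wsP w wws.
have neq_tw t : phi t \notin rcons ws w -> t != tw.
  by apply: contraNneq => ->; rewrite twE.
have QP m t : (m <= n - k)%N -> in01 t -> phi t \notin rcons ws w ->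
    arc_derivn phi (fun z => divdiff f (z :: rcons ws w)) m (phi t) (quot phi tw G m t).
  apply: (chain_arc_derivn adm) => {m t}.
    by move=> t t01 tn; rewrite -twE; apply: (quot0_divdiff adm) => //; rewrite twE.
  by move=> m t mN t01 /neq_tw ttw; apply: (quot_cderiv_off adm tw01 GD).
have nodes (S : seq R[i]) t : in01 t -> t \notin map (phi_inv phi) S -> phi t \notin S.
  move=> t01; apply: contraNN => tS; apply/mapP; exists (phi t) => //.
  by rewrite (phi_invK adm).
split.
- have [M M0 MP] := quot_bounded adm tw01 GL GD (leqnn (n - k)).
  exists M; apply: (@ae01_of _ _ (fun=> True) (map (phi_inv phi) (rcons ws w))).
    exact: aeW.
  move=> t t01 /(nodes _ _ t01) tn _; exists (quot phi tw G (n - k) t); [exact: QP|exact: MP].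
- move=> m mN; exists (quot phi tw G m); split.
    exact/lipschitz01_abs_cont/(quot_lipschitz adm tw01 GL GD).
  by move=> t t01 tn; apply: QP => //; exact: ltnW.
- move=> m mN t1 tw' t101 tw'01 tw'E t1n.
  have {tw' tw'01 tw'E} -> : tw' = tw by apply: (phi_inj adm) => //; rewrite tw'E.
  have [g [gr gi gd _]] := lipschitz01_density (GL m mN).
  (* Dividing by [dphi] turns the parameter derivative of [G m] into a derivative along the arc. At
     the top order [m = n - k] the chain provides it only almost everywhere. *)
  exists (fun t => g t / dphi t).
  have gE t : in01 t -> g t / dphi t * dphi t = g t.
    by move=> t01; rewrite divfK // (dphi_neq0 adm).
  pose J t := (phi t - phi tw) ^+ m.+1 * quot phi tw G m t.
  have lJ : lipschitz01 J := quot_primitive_lipschitz adm tw01 GL GD mN.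
  have [||cI cE] := @cint_density _ J
    (fun t => (phi t - w) ^+ m * (g t / dphi t) * dphi t) lJ _ _ _ _ tw01 t101.
  + apply: (@eq_cmeasurable _ (fun t => (phi t - w) ^+ m * g t)).
      by move=> t t01; rewrite -mulrA gE.
    apply: cmeasurableM.
      apply: lipschitz01_cmeasurable; apply: lipschitz01X; apply: lipschitz01B.
        exact: (phi_lipschitz adm).
      exact: lipschitz01_cst.
    by split; [move: gr|move: gi] => /measurable_int/measurable_EFinP.
  + have ntw : {ae @lebesgue_measure R, forall t, t != tw}.
      exists [set tw]; split => //; first exact: lebesgue_measure_set1.
      by move=> t /= /negP; rewrite negbK => /eqP.
    apply: filterS2 ntw gd; first exact: (ae_filter_ringOfSetsType (@lebesgue_measure R)).
    move=> t ttw gd t01; have t01' : in01 t by case/andP: t01 => *; apply/andP; split; exact: ltW.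
    rewrite -mulrA gE // -twE.
    by apply: (quot_primitive_cderiv adm tw01 GD mN t01' ttw); exact: gd.
  split; [|split=> //].
    (* Besides the null set of [gd], the endpoints are excluded, where [gd] says nothing, and the
       parameters of the nodes [ws]. *)
    apply: (@ae01_of _ _ _ ([:: 0; 1] ++ map (phi_inv phi) ws) gd).
    move=> t t01; rewrite mem_cat negb_or !inE negb_or => /andP[/andP[t0 t1'] /(nodes _ _ t01) tn] gt.
    have t01' : 0 < t < 1.
      by case/andP: t01 => h0 h1; rewrite !lt_neqAle h0 h1 eq_sym t0 t1'.
    apply: (arc_derivnS adm (G := G m) (S := ws)) => //.
      by move=> s s01 sn; apply: (chain_arc_derivn adm (N := (n - k)%N) G0) => // m' s' m'N s'01 _; exact: GD.
    by rewrite gE //; exact: gt.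
  (* The integral therefore equals [J t1], and dividing by the power of [phi t1 - w] leaves
     [quot m]. *)
  have Jtw : J tw = 0 by rewrite /J subrr expr0n mul0r.
  rewrite cE Jtw subr0 /J twE mulrC mulKf; first exact: QP.
  by rewrite -twE expf_neq0 // (psi_neq0 adm) // neq_tw.
Qed.
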